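(* Suppose $E$ is a weakly uniformly properly group-like, analytic equivalence relation on an ambit $(G,X,x_0)$, where $X$ is an arbitrary compact Hausdorff space. Then $X/E$ (with the quotient topology) is the topological quotient of a compact Hausdorff group by an analytic subgroup. Consequently, $E$ is either clopen (as a subset of $X^2$), or it has at least $2^{\aleph_0}$ classes. Moreover, if $E$ is not closed, then for every closed and $E$-saturated $Y\subseteq X$, the restriction $E\restriction_Y$ has at least $2^{\aleph_0}$ classes.
   Context: Setting and definitions used in the claim: - An ambit $(G,X,x_0)$: $G$ is a group acting by homeomorphisms on a compact Hausdorff space $X$, and $x_0\in X$ has dense $G$-orbit. A morphism of $G$-ambits $(Z,z_0)\to(X,x_0)$ is a continuous $G$-equivariant surjection sending $z_0$ to $x_0$. - A subset of a topological space is analytic if it is obtained by the Souslin operation $\bigcup_{s\in\omega^\omega}\bigcap_n P_{s\restriction n}$ applied to a family $(P_s)_{s\in\omega^{<\omega}}$ of closed sets. - $E$ on $X$ is group-like if it is $G$-invariant and the partial operation $[gx_0]_E\cdot[x]_E=g[x]_E$ ($g\in G$, $x\in X$) extends to a group operation making $X/E$ a (possibly non-Hausdorff) topological group with the quotient topology. - $E$ is properly group-like if it is group-like and there are a group $\tilde G$, an equivalence relation $\equiv$ on $\tilde G$ and an identification $X=\tilde G/{\equiv}$ such that: (i) $\tilde g\mapsto[[\tilde g]_\equiv]_E$ is a group homomorphism $\tilde G\to X/E$; (ii) (pseudocompleteness) whenever $(g_i)$ is a net in $G$ and $(p_i)$ a net in $X$ with $g_ix_0\to x_1$, $p_i\to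 x_2$, $g_ip_i\to x_3$, there are $\tilde g_1,\tilde g_2\in\tilde G$ with $[\tilde g_1]_\equiv=x_1$, $[\tilde g_2]_\equiv=x_2$, $[\tilde g_1\tilde g_2]_\equiv=x_3$; (iii) the set $\{[\tilde g_1^{-1}\tilde g_2]_\equiv\mid \tilde g_1\equiv\tilde g_2\}$ is closed in $X$. - $E$ is uniformly properly group-like if it is properly group-like (via some $\tilde G$) and $E=\bigcup\mathcal E$ for a family $\mathcal E$ of closed symmetric subsets of $X^2$ containing the diagonal such that for every $D\in\mathcal E$ there is $D'\in\mathcal E$ with $D\circ D\subseteq D'$ (relation composition) and such that whenever $(x_0,[\tilde g]_\equiv)\in D$, then $([\tilde g']_\equiv,[\tilde g\tilde g']_\equiv)\in D'$ for all $\tilde g'\in\tilde G$. - A group-like equivalence relation $F$ on a $G$-ambit $(Z,z_0)$ dominates $E$ on $(X,x_0)$ if there is an ambit morphism $\varphi\colon Z\to X$ such that $F$ refines the pullback of $E$ via $\varphi$ and the induced map $Z/F\to X/E$ is equivariant with respect to some left action of the group $Z/F$ on $X/E$. - $E$ is weakly uniformly properly group-like if it is dominated by some uniformly properly group-like equivalence relation (on some $G$-ambit). - $Y$ being $E$-saturated means $Y$ is a union of $E$-classes. *)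

(* Defs.v *)
From HB Require Import structures.
From mathcomp Require Import all_boot all_classical topology.

Set Implicit Arguments.
Unset Strict Implicit.
Unset Printing Implicit Defensive.

Local Open Scope quotient_scope.
Local Open Scope group_scope.
Local Open Scope classical_set_scope.

Definition souslin (T : Type) (P : seq nat -> set T) : set T :=
  \bigcup_(s in [set: nat -> nat]) \bigcap_(n in [set: nat]) P (mkseq s n).

Definition analytic (T : topologicalType) (A : set T) : Prop :=
  exists2 P : seq nat -> set T, (forall u, closed (P u)) & A = souslin P.

Definition homeomorphic (S T : topologicalType) : Prop :=
  exists (f : S -> T) (g : T -> S),
    [/\ continuous f, continuous g, cancel f g & cancel g f].

(* The quotients below are types with a structure of their own, on which a
   group law is extra data: a law on T is an inhabitant of [Group.axioms_ T],
   the class such that [Group.Pack c : groupType] has carrier T. *)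
Definition group_law (T : Type) : Type := Group.axioms_ T.
Definition law_group (T : Type) (c : group_law T) : groupType := Group.Pack c.
Definition lmul (T : Type) (c : group_law T) (x y : T) : T :=
  ((x : law_group c) * (y : law_group c))%g.
Definition lone (T : Type) (c : group_law T) : T := (1 : law_group c)%g.
Definition linv (T : Type) (c : group_law T) (x : T) : T :=
  ((x : law_group c)^-1)%g.

Definition topological_group (T : topologicalType) (c : group_law T) : Prop :=
  continuous (fun xy : T * T => lmul c xy.1 xy.2) /\ continuous (linv c).

Section LeftCosets.
Variables (K : groupType) (H : groupClosed K).

Definition lcoset_rel : rel K := fun x y => x^-1 * y \in H.

Lemma lcoset_rel_equiv : equiv_class_of lcoset_rel.
Proof.
rewrite /lcoset_rel; split=> [x|x y|y x z].
- by rewrite mulVg gpred1.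
- by rewrite -[in LHS](gpredV H) invgM invgK.
- by move=> xy yz; have := gpredM _ _ xy yz; rewrite mulgA mulgK.
Qed.

Canonical lcoset_equiv : equiv_rel K := EquivRelPack lcoset_rel_equiv.
End LeftCosets.

Section EquivalenceRelations.
Variable X : topologicalType.
Implicit Type E : equiv_rel X.

Definition graph_of E : set (X * X) := [set p | E p.1 p.2].

Definition quot E : topologicalType := quotient_topology {eq_quot E}.
Definition cls E (x : X) : quot E := \pi_{eq_quot E} x.

Definition saturated E (Y : set X) : Prop :=
  exists A : set X, Y = \bigcup_(x in A) [set y | E x y].

Definition restricted_classes E (Y : set X) : set (set X) :=
  [set Y `&` [set z | E y z] | y in Y].

End EquivalenceRelations.

Definition at_least_continuum (T : Type) (A : set T) : Prop :=
  ([set: nat -> bool] #<= A)%card.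

Definition quotient_of_compact_group (S : topologicalType) : Prop :=
  exists (K : topologicalType) (c : group_law K) (H : groupClosed (law_group c)),
    [/\ topological_group c, compact [set: K], hausdorff_space K,
        analytic ([set x | x \in H] : set K)
      & homeomorphic S (@quot K (lcoset_equiv H))].

(* Each [act g] is a homeomorphism, its inverse being [act g^-1]. *)
Record ambit (G : groupType) := Ambit {
  space :> topologicalType;
  act : G -> space -> space;
  base : space;
  space_compact : compact [set: space];
  space_hausdorff : hausdorff_space space;
  act_one : forall x, act 1 x = x;
  act_mul : forall g h x, act (g * h) x = act g (act h x);
  act_continuous : forall g, continuous (act g);
  base_dense : dense (range (fun g => act g base))
}.
Arguments act {G a}.
Arguments base {G a}.

Definition ambit_morphism (G : groupType) (Z X : ambit G) (phi : Z -> X) :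
    Prop :=
  [/\ continuous phi, forall g z, phi (act g z) = act g (phi z),
      forall x, exists z, phi z = x & phi base = base].

Definition directed (I : Type) (le : I -> I -> Prop) : Prop :=
  [/\ inhabited I, forall i, le i i,
      forall i j k, le i j -> le j k -> le i k
    & forall i j, exists2 k, le i k & le j k].

Definition net_to (I : Type) (le : I -> I -> Prop) (X : topologicalType)
    (u : I -> X) (x : X) : Prop :=
  u @ filter_from [set: I] (fun i => [set j | le i j]) --> x.

Section GroupLike.
Variables (G : groupType) (X : ambit G) (E : equiv_rel X).

(* The group law c on X/E need not be determined by E, hence is a parameter. *)
Definition group_like_law (c : group_law (quot E)) : Prop :=
  [/\ forall g x y, E x y -> E (act g x) (act g y),
      forall g x, lmul c (cls E (act g base)) (cls E x) = cls E (act g x)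
    & topological_group c].

Section Via.
Variables (Gt : groupType) (eqv : equiv_rel Gt) (i : {eq_quot eqv} -> X).
Let pt (g : Gt) : X := i (\pi_{eq_quot eqv} g).

Definition pseudocomplete : Prop :=
  forall (I : Type) (le : I -> I -> Prop) (g : I -> G) (p : I -> X)
    (x1 x2 x3 : X), directed le ->
    net_to le (fun j => act (g j) base) x1 -> net_to le p x2 ->
    net_to le (fun j => act (g j) (p j)) x3 ->
  exists g1 g2 : Gt, [/\ pt g1 = x1, pt g2 = x2 & pt (g1 * g2) = x3].

Definition properly_group_like_via (c : group_law (quot E)) : Prop :=
  [/\ group_like_law c, bijective i,
      forall g h, cls E (pt (g * h)) = lmul c (cls E (pt g)) (cls E (pt h)),
      pseudocomplete
    & closed [set x | exists g1 g2 : Gt, eqv g1 g2 /\ x = pt (g1^-1 * g2)]].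

Definition uniformity_via : Prop :=
  exists EE : set (set (X * X)),
  [/\ forall D, EE D ->
        [/\ closed D, (D^-1)%relation = D & diagonal `<=` D],
      graph_of E = \bigcup_(D in EE) D
    & forall D, EE D -> exists D', [/\ EE D', (D \; D)%relation `<=` D'
        & forall g : Gt, D (base, pt g) ->
            forall g' : Gt, D' (pt g', pt (g * g'))]].

End Via.

Definition uniformly_properly_group_like_law (c : group_law (quot E)) : Prop :=
  exists (Gt : groupType) (eqv : equiv_rel Gt) (i : {eq_quot eqv} -> X),
    properly_group_like_via i c /\ uniformity_via i.

End GroupLike.

Definition is_left_action (T S : Type) (c : group_law T) (a : T -> S -> S) :
    Prop :=
  (forall s, a (lone c) s = s) /\
  (forall p q s, a (lmul c p q) s = a p (a q s)).

Definition dominates (G : groupType) (Z X : ambit G) (F : equiv_rel Z)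
    (c : group_law (quot F)) (E : equiv_rel X) : Prop :=
  exists phi : Z -> X,
  [/\ ambit_morphism phi, forall z z', F z z' -> E (phi z) (phi z')
    & let phi' (q : quot F) : quot E := cls E (phi (repr q)) in
      exists2 a : quot F -> quot E -> quot E, is_left_action c a &
        forall p q, phi' (lmul c p q) = a p (phi' q)].

Definition weakly_uniformly_properly_group_like (G : groupType) (X : ambit G)
    (E : equiv_rel X) : Prop :=
  exists (Z : ambit G) (F : equiv_rel Z) (c : group_law (quot F)),
    uniformly_properly_group_like_law c /\ dominates c E.

(* Main.v *)
(** Let [S] be the enveloping (Ellis) semigroup of the dominating ambit [Z], [M] a
    minimal left ideal of [S] and [u] an idempotent of [M].  Pseudocompleteness
    says that [f |-> [f(z0)]_F] respects limits of products,
      so it restricts to a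
    surjective homomorphism from the group [uM] onto [Z/F],
      and it identifies any
    two points of [uM] that are inseparable in the tau-topology.  The Hausdorff
    reflection [K] of [uM] is therefore a compact Hausdorff group mapping onto
    [Z/F], and [X/E] is [K/H] for the stabiliser [H] of the class of [x0].
    A continuous map onto [K] from the closure of [uM] shows that [H] is
      analytic.

    An analytic subgroup of a compact Hausdorff group is meager or comeager in
      some
    nonempty open set.  In the second case it is open; in the first one a Cantor
    scheme gives continuum many cosets.  This is applied in [K], and in the
    closure of [H]. *)
From HB Require Import structures.
Require Import Defs.
From mathcomp Require Import all_boot all_classical topology.

Set Implicit Arguments.
Unset Strict Implicit.
Unset Printing Implicit Defensive.

Local Open Scope quotient_scope.
Local Open Scope classical_set_scope.

(** * Preliminaries on topological spaces *)

(** In [S] only the right translations, and the left translations by elements of [G], are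
    continuous. Limit arguments therefore replace the left factor of a product by a nearby
    translation of [G], which is also the form in which pseudocompleteness applies. The tau-topology
    compensates for the discontinuity of left multiplication by [u]: it is compact with separately
    continuous product, but in general it is neither Hausdorff nor the topology of [S]. This forces
    both the reflection [K] and a second compact space, the closure of [uM] in [S], which maps
    continuously to [K] and to [S]. Through it closedness and analyticity travel from [X] to [K].
    The way back, from closed sets of [K] to closed sets of [X], must handle elements of [S] outside
    [uM] and is the delicate half of the comparison of topologies. Nothing is metrizable or second
    countable here, so the category arguments rest on compactness alone: nested closed sets along a
    branch have a common point, one of which is chosen, and no diameters shrink. *)

Lemma compact_nested (T : topologicalType) (C : nat -> set T) :
  compact [set: T] -> (forall n, closed (C n)) -> (forall n, C n !=set0) ->
  (forall n, C n.+1 `<=` C n) -> \bigcap_n C n !=set0.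
Proof.
move=> cT clC C0 Cs.
have Cle m n : (m <= n)%N -> C n `<=` C m.
  move=> /subnK <-; elim: (n - m)%N => [//|k IH].
  exact: subset_trans (Cs _) IH.
have FF : ProperFilter (filter_from [set: nat] C).
  apply: filter_from_proper => [|n _]; last exact: C0.
  apply: filter_from_filter => [|m n _ _]; first by exists 0%N.
  exists (maxn m n) => // x Cx; split; apply: Cle Cx; [exact: leq_maxl
    |exact: leq_maxr].
have [|x [_ xC]] := cT _ FF; first by exists 0%N.
exists x => n _; apply: clC => W Wx; apply: xC => //; by exists n.
Qed.

Lemma shrink_open (T : topologicalType) (O : set T) (x : T) :
  compact [set: T] -> hausdorff_space T -> open O -> O x ->
  exists V : set T, [/\ open V, V x & closure V `<=` O].
Proof.
move=> cT hT oO Ox.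
have := @compact_regular T x setT hT cT filterT O (open_nbhs_nbhs (conj oO Ox)).
move=> [W Wx WO]; exists W°; split; first exact: open_interior.
  exact: nbhs_singleton (nbhs_interior Wx).
apply: subset_trans WO; apply: closureS; exact: interior_subset.
Qed.

Lemma prod_nbhsP (S T : topologicalType) (x : S) (y : T) (W : set (S * T)) :
  nbhs (x, y) W -> exists U V : _,
    [/\ open U, open V, U x, V y & U `*` V `<=` W].
Proof.
move=> [[A B] [/= Ax By] AB]; exists A°, B°; split; try exact: open_interior.
- exact: Ax.
- exact: By.
- by move=> [a b] [/= Aa Bb]; apply: AB; split; exact: interior_subset.
Qed.

Lemma pair_cont (R S T : topologicalType) (f : R -> S) (g : R -> T) :
  continuous f -> continuous g -> continuous (fun x => (f x, g x)).
Proof.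
move=> cf cg x W [[A B] [/= Ax By] AB].
by near=> y; apply: AB; split => /=; near: y; [exact: cf|exact: cg].
Unshelve. all: by end_near. Qed.

Lemma cst_cont (S T : topologicalType) (x : T) : continuous (fun _ : S => x).
Proof. by move=> y; exact: cst_continuous. Qed.

Lemma id_cont (S : topologicalType) : continuous (fun x : S => x).
Proof. by move=> y. Qed.

Lemma comp_cont (R S T : topologicalType) (f : R -> S) (g : S -> T) :
  continuous f -> continuous g -> continuous (fun x => g (f x)).
Proof. by move=> cf cg x; apply: continuous_comp; [exact: cf|exact: cg]. Qed.

Lemma closed_comp_cont (S T : topologicalType) (f : S -> T) (B : set T) :
  continuous f -> closed B -> closed [set x | B (f x)].
Proof. by move=> cf cB; apply: (@preimage_closed _ _ f) => // x _;
  exact: cf. Qed.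

Lemma open_comp_cont (S T : topologicalType) (f : S -> T) (B : set T) :
  continuous f -> open B -> open [set x | B (f x)].
Proof. by move=> cf oB; apply: (@open_comp _ _ f) => // x _; exact: cf. Qed.

Lemma cluster_cont (S T : topologicalType) (f : S -> T) (p q : S) :
  continuous f -> cluster (nbhs p) q -> cluster (nbhs (f p)) (f q).
Proof.
move=> cf pq A B /cf Ap /cf Bq; have [x [Ax Bx]] := pq _ _ Ap Bq.
by exists (f x).
Qed.

Lemma hausdorff_inj (S T : topologicalType) (f : S -> T) :
  continuous f -> injective f -> hausdorff_space T -> hausdorff_space S.
Proof. by move=> cf fI hT p q /(cluster_cont cf)/hT/fI. Qed.

Lemma hausdorff_prod (S T : topologicalType) :
  hausdorff_space S -> hausdorff_space T -> hausdorff_space (S * T)%type.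
Proof.
move=> hS hT [a b] [a' b'] pq.
have c1 : continuous (@fst S T) by move=> x; exact: cvg_fst.
have c2 : continuous (@snd S T) by move=> x; exact: cvg_snd.
by congr (_, _); [apply: hS; exact: (cluster_cont c1 pq)|apply: hT;
  exact: (cluster_cont c2 pq)].
Qed.

Lemma compactT_setX (S T : topologicalType) :
  compact [set: S] -> compact [set: T] -> compact [set: S * T].
Proof. by move=> cS cT; rewrite -setXTT; exact: compact_setX. Qed.

Lemma set_val_cont (T : topologicalType) (A : set T) : continuous (@set_val T
  A).
Proof. exact: initial_continuous. Qed.

Lemma compact_set_type (T : topologicalType) (A : set T) :
  compact A -> compact [set: set_type A].
Proof.
move=> cA F FF _.
have FA : F (set_val @^-1` A) by apply: filterE => x; exact: set_valP.
have [p [Ap pF]] := cA (set_val @ F) _ FA.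
pose x : set_type A := SigSub (mem_set Ap).
exists x; split=> // B N FB; rewrite nbhsE => -[_ [[W oW <-] Wx] WN].
have FB' : F (set_val @^-1` [set set_val y | y in B]).
  by apply: filterS FB => y By; exists y.
have [_ [[y By <-] Wy]] := pF _ _ FB' (open_nbhs_nbhs (conj oW Wx)).
by exists y; split=> //; exact: WN.
Qed.

Lemma hausdorff_set_type (T : topologicalType) (A : set T) :
  hausdorff_space T -> hausdorff_space (set_type A).
Proof. by apply: (hausdorff_inj (@set_val_cont T A)); exact: val_inj. Qed.

Lemma closed_map_compact (S T : topologicalType) (f : S -> T) (A : set S) :
  compact [set: S] -> hausdorff_space T -> continuous f -> closed A ->
  closed (f @` A).
Proof.
move=> cS hT cf cA; apply: compact_closed => //.
apply: continuous_compact; first exact: continuous_subspaceT.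
exact: subclosed_compact cS _.
Qed.

(** * Baire category and Souslin sets *)

Section Category.
Variable T : topologicalType.
Implicit Types A B O : set T.

Definition meager A := exists2 F : nat -> set T,
  forall n, closed (F n) /\ interior (F n) = set0 & A `<=` \bigcup_n F n.

Lemma meagerS A B : A `<=` B -> meager B -> meager A.
Proof. by move=> AB [F Fn BF]; exists F => //; exact: subset_trans BF. Qed.

Lemma meager0 : meager set0.
Proof. by exists (fun=> set0) => // n; split; [exact: closed0
  |exact: interior0]. Qed.

Lemma meager_bigcup (I : countType) (B : I -> set T) :
  (forall i, meager (B i)) -> meager (\bigcup_i B i).
Proof.
move=> mB.
have /choice[F FP] : forall i, exists F : nat -> set T,
    (forall n, closed (F n) /\ interior (F n) = set0) /\ B i `<=` \bigcup_n F n.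
  by move=> i; have [F F1 F2] := mB i; exists F.
exists (fun m => if @unpickle (I * nat)%type m is Some q then F q.1 q.2 else
  set0).
  move=> m; case: unpickle => [[i n]|]; first exact: (FP i).1.
  by split; [exact: closed0|exact: interior0].
move=> x [i _ /(FP i).2[n _ Fx]]; exists (pickle (i, n)) => //.
by rewrite pickleK.
Qed.

Lemma meagerU A B : meager A -> meager B -> meager (A `|` B).
Proof.
move=> mA mB; have := @meager_bigcup bool (fun b => if b then A else B).
move=> H; apply: meagerS (H _); last by case.
by move=> x [Ax|Bx]; [exists true|exists false].
Qed.

Lemma closed_meager A : closed A -> interior A = set0 -> meager A.
Proof. by move=> cA iA; exists (fun=> A) => // x Ax; exists 0%N. Qed.

(* Banach category theorem: disjointness of the chosen open pieces makes the
   union of their n-th nowhere dense parts nowhere dense. *)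
Lemma nonmeager_localize B : ~ meager B ->
  exists O, [/\ open O, O !=set0 & forall V, open V -> V !=set0 -> V `<=` O ->
    ~ meager (B `&` V)].
Proof.
move=> nB; apply: contrapT => H.
have {}H O : open O -> O !=set0 ->
    exists V, [/\ open V, V !=set0, V `<=` O & meager (B `&` V)].
  move=> oO O0; apply: contrapT => H'; apply: H; exists O;
    split=> // V oV V0 VO mV.
  by apply: H'; exists V.
pose D : set (set T) := [set V | [/\ open V, V !=set0 & meager (B `&` V)]].
have [E [ED tE maxE]] := ex_maximal_disjoint_subcollection (fun V : set T =>
  V) D.
pose W := \bigcup_(V in E) V.
have oW : open W by apply: bigcup_open => V /ED[].
(* By maximality of [E] its union [W] is dense, so the part of [B] outside [W] is nowhere dense. *)
have dW O : open O -> O !=set0 -> O `&` W !=set0.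
  move=> oO O0; apply: contrapT => OW0.
  have [V [oV V0 VO mV]] := H _ oO O0.
  have VU U : E U -> V `&` U !=set0 -> False.
    by move=> EU [x [Vx Ux]]; apply: OW0; exists x; split; [exact: VO|exists U].
  apply: (maxE (E `|` [set V])).
  - split; first by move=> U; left.
    move=> /(_ V (or_intror erefl)) EV.
    by case: V0 => x Vx; apply: VU (EV) _; exists x.
  - by move=> U [/ED//|->]; split.
  - move=> U1 U2 [E1|->] [E2|->] //.
    + exact: tE.
    + by move=> [x [x1 x2]]; case: (VU _ E1); exists x.
    + by move=> [x [x1 x2]]; case: (VU _ E2); exists x.
have /choice[F FP] : forall V, exists F : nat -> set T, E V ->
    (forall n, closed (F n) /\ interior (F n) = set0) /\ B `&` V `<=` \bigcup_n
      F n.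
  move=> V; have [/ED[_ _ [F F1 F2]]|nE] := pselect (E V); first by exists F.
  by exists (fun=> set0).
pose N n := closure (\bigcup_(V in E) (F V n `&` V)).
apply: nB; apply: (@meagerS _ (~` W `|` \bigcup_n N n)).
  move=> x Bx; have [[V EV Vx]|nW] := pselect (W x); last by left.
  right; have [_ /(_ x (conj Bx Vx))[n _ Fx]] := FP V EV.
  by exists n => //; apply: subset_closure; exists V.
apply: meagerU.
  apply: closed_meager; first exact: open_closedC.
  rewrite -subset0 => x xW.
  have [y [Wy1 Wy2]] := dW _ (open_interior _) (ex_intro _ x xW).
  exact: interior_subset Wy1 Wy2.
apply: meager_bigcup => n; apply: closed_meager; first exact: closed_closure.
rewrite -subset0 => x xN.
have [y [Ny [V EV Vy]]] := dW _ (open_interior _) (ex_intro _ x xN).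
have [oV _ _] := ED _ EV; have [Fcl _] := FP V EV; have [cF iF] := Fcl n.
suff : interior (F V n) y by rewrite iF.
rewrite /interior; apply: filterS (open_nbhs_nbhs (conj (openI (open_interior
  (N n)) oV) (conj Ny Vy))).
move=> z [Nz Vz]; apply: cF => O Oz.
have [w [[U EU [Fw Uw]] [Ow Vw]]] := interior_subset Nz _ (filterI Oz
  (open_nbhs_nbhs (conj oV Vz))).
have UV : U = V by apply: tE => //; exists w.
by exists w; split => //; rewrite -UV.
Qed.

(** The Baire category theorem: nonempty open sets whose closures are nested and avoid the [F n] one
    after the other leave a common point by compactness. *)
Lemma open_nonmeager O : compact [set: T] -> hausdorff_space T ->
  open O -> O !=set0 -> ~ meager O.
Proof.
move=> cT hT oO [x0 Ox0] [F FP OF].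
have step n (V : set T) : exists V' : set T, open V -> V !=set0 ->
    [/\ open V', V' !=set0 & closure V' `<=` V `\` F n].
  have [[oV [x Vx]]|nV] := pselect (open V /\ V !=set0); last first.
    by exists set0 => oV V0; case: nV.
  have [cF iF] := FP n.
  have [y [Vy Fy]] : exists y, V y /\ ~ F n y.
    apply: contrapT => H; have : interior (F n) x; last by rewrite iF.
    apply: filterS (open_nbhs_nbhs (conj oV Vx)) => y Vy.
    by apply: contrapT => Fy; apply: H; exists y.
  have [//|//|||V' [oV' V'y cV']] := @shrink_open T (V `\` F n) y.
  - exact: openI oV (closed_openC cF).
  - by [].
  - by exists V' => _ _; split=> //; exists y.
have /choice[g gP] : forall p : nat * set T, exists V' : set T,
    open p.2 -> p.2 !=set0 ->
    [/\ open V', V' !=set0 & closure V' `<=` p.2 `\` F p.1].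
  by move=> [n V]; exact: step.
pose U := fix U n := if n is m.+1 then g (m, U m) else O.
have UP n : open (U n) /\ U n !=set0.
  elim: n => [|n [IH1 IH2]]; first by split=> //; exists x0.
  by have [] := gP (n, U n) IH1 IH2.
have UF n : closure (U n.+1) `<=` U n `\` F n.
  by have [oU U0] := UP n; have [] := gP (n, U n) oU U0.
have [x xU] : \bigcap_n closure (U n.+1) !=set0.
  apply: compact_nested => // n; first exact: closed_closure.
    by have [_ [y]] := UP n.+1; exists y; exact: subset_closure.
  by apply: closureS => y Uy; have [] := UF n.+1 y (subset_closure Uy).
have [Ox _] := UF 0%N x (xU 0%N I).
have [n _ Fx] := OF x Ox.
by have [] := UF n x (xU n I).
Qed.

(* U s is the open set in which the part of the Souslin set passing through s
   is everywhere nonmeager; along it one can choose a branch outside a meager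
   set. *)
Lemma souslin_nonmeager (P : seq nat -> set T) : (forall s, closed (P s)) ->
  ~ meager (souslin P) ->
  exists O, [/\ open O, O !=set0 & meager (O `\` souslin P)].
Proof.
move=> cP nA.
pose A s : set T := [set x | exists2 a : nat -> nat, mkseq a (size s) = s &
  forall n, P (mkseq a n) x].
have AP s : A s `<=` P s by move=> x [a as_ aP]; rewrite -as_; exact: aP.
have AU s : A s `<=` \bigcup_n A (rcons s n).
  move=> x [a as_ aP]; exists (a (size s)) => //; exists a => //.
  by rewrite size_rcons /mkseq -addn1 iotaD map_cat -/(mkseq _ _) as_ cats1.
have A0 : A [::] = souslin P.
  apply/seteqP; split=> x [a _ aP]; exists a => // n; exact: (aP n I).
pose good s O := open O /\ forall V, open V -> V !=set0 -> V `<=` O ->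
  ~ meager (A s `&` V).
pose U s := \bigcup_(O in good s) O.
have oU s : open (U s) by apply: bigcup_open => O [].
(* A point of [U s] outside the closed set [P s] would have a neighbourhood that misses [A s],
   although [A s] is nonmeager in every nonempty open part of a good [O]. *)
have UA s : U s `<=` P s.
  move=> x [O [oO gO] Ox]; apply: cP => W Wx; apply: contrapT => AW.
  have OW : nbhs x (O `&` W) by apply: filterI => //; exact: open_nbhs_nbhs.
  apply: (gO (O `&` W)°); first exact: open_interior.
  - exists x; exact: nbhs_singleton (nbhs_interior OW).
  - by move=> y /interior_subset[].
  - apply: meagerS meager0 => y [/AP Py /interior_subset[_ Wy]].
    by apply: AW; exists y.
have [O [oO O0 gO]] : exists O, [/\ open O, O !=set0 & good [::] O].
  rewrite -A0 in nA; have [O [oO O0 gO]] := nonmeager_localize nA.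
  by exists O; split.
exists O; split=> //.
(* The exceptional points lie in some [U s] but in no [U (rcons s n)]. Each such difference [Q] is
   nowhere dense: in an open [V] inside its closure [A s] would be nonmeager, hence so would one of
   the countably many [A (rcons s n)], and localizing that one makes [U (rcons s n)] meet [V]. *)
apply: (@meagerS _ (\bigcup_s (U s `\` \bigcup_n U (rcons s n)))); last first.
  apply: meager_bigcup => s.
  set Q := U s `\` _.
  apply: (@meagerS _ (closure Q)); first exact: subset_closure.
  apply: closed_meager; first exact: closed_closure.
  rewrite -subset0 => x xQ.
  have [y [Qy iy]] := interior_subset xQ _ (nbhs_interior xQ).
  have [[O' [oO' gO'] O'y] _] := Qy.
  pose V := O' `&` (closure Q)°.
  have oV : open V by apply: openI => //; exact: open_interior.
  have VQ n : V `&` U (rcons s n) = set0.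
    rewrite -subset0 => z [[O'z /interior_subset Qz] Uz].
    have [w [[_ nUw] Uw]] := Qz _ (open_nbhs_nbhs (conj (oU (rcons s n)) Uz)).
    by apply: nUw; exists n.
  have : ~ meager (A s `&` V).
    by apply: gO' => //; [exists y|move=> z []].
  apply; apply: (@meagerS _ (\bigcup_n (A (rcons s n) `&` V))).
    by move=> z [/AU[n _ Az] Vz]; exists n.
  apply: meager_bigcup => n; apply: contrapT => nm.
  have [O1 [oO1 [z O1z] gO1]] := nonmeager_localize nm.
  have VO1 : V `&` O1 !=set0.
    apply: contrapT => e; apply: (gO1 O1) => //; first by exists z.
    by apply: meagerS meager0 => w [[_ Vw] Ow]; apply: e; exists w.
  have : U (rcons s n) `&` V !=set0.
    have [w [Vw Ow]] := VO1; exists w; split=> //.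
    exists (V `&` O1) => //; split; first exact: openI.
    move=> V' oV' V'0 V'O m; apply: (gO1 V') => //; first by move=> v /V'O[].
    by apply: meagerS m => v [[? _] ?]; split.
  by rewrite setIC VQ => -[].
move=> x [Ox nAx]; apply: contrapT => nx.
(* Outside the exceptional set a point of [U s] can be followed to a child forever; by [UA] the
   resulting branch witnesses membership in the Souslin set. *)
have next s : exists n, U s x -> U (rcons s n) x.
  have [Us|nU] := pselect (U s x); last by exists 0%N.
  apply: contrapT => H; apply: nx; exists s => //; split=> // -[n _ Un].
  by apply: H; exists n.
have [h hP] := choice next.
pose sg := fix sg n := if n is m.+1 then rcons (sg m) (h (sg m)) else [::].
have sgU n : U (sg n) x.
  elim: n => [|n IH] /=; first by exists O.
  exact: hP.
have sgE n : mkseq (fun i => h (sg i)) n = sg n.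
  elim: n => [//|n IH] /=.
  by rewrite -IH /mkseq -addn1 iotaD map_cat -/(mkseq _ _) IH /= cats1.
apply: nAx; exists (fun i => h (sg i)) => // n _.
by rewrite sgE; apply: UA.
Qed.

End Category.

(** * Cantor schemes *)

Section CantorScheme.
Variables (T : topologicalType) (F : nat -> set (T * T)).
Hypotheses (cT : compact [set: T]) (hT : hausdorff_space T).
Hypotheses (cF : forall n, closed (F n)) (iF : forall n, interior (F n) = set0).

Definition open_family (I : Type) (U : I -> set T) :=
  forall i, open (U i) /\ U i !=set0.

(** One constraint at a time: [F n] has empty interior, so the box [V i] times [V j] contains a
    point outside it and a smaller box around that point avoids it. Since [i] and [j] differ, the
    two factors shrink independently. *)
Lemma refine_open_family (I : eqType) (U : I -> set T) (l : seq (I * I * nat)) :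
  open_family U -> {in l, forall p, p.1.1 != p.1.2} ->
  exists V : I -> set T, [/\ open_family V, forall i, V i `<=` U i &
    {in l, forall p x y, V p.1.1 x -> V p.1.2 y -> ~ F p.2 (x, y)}].
Proof.
move=> oU; elim: l => [|[[i j] n] l IH] ne; first by exists U; split=> // i.
have [|V [oV VU VF]] := IH; first by move=> p pl; apply: ne;
  rewrite inE pl orbT.
have ij : i != j by apply: (ne (i, j, n)); rewrite inE eqxx.
have [x [y [Vx Vy nF]]] : exists x y, [/\ V i x, V j y & ~ F n (x, y)].
  apply: contrapT => H; have [[oi [x Vx]] [oj [y Vy]]] := (oV i, oV j).
  suff : interior (F n) (x, y) by rewrite iF.
  exists (V i, V j) => /=; first by split; apply: open_nbhs_nbhs.
  move=> [a b] [/= Va Vb]; apply: contrapT => nF.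
  by apply: H; exists a, b.
have [A [B [oA oB Ax By AB]]] :=
  prod_nbhsP (open_nbhs_nbhs (conj (closed_openC (cF (n := n))) nF)).
pose W k := V k `&` (if k == i then A else if k == j then B else setT).
exists W; split.
- move=> k; rewrite /W; have [oVk [z Vz]] := oV k.
  case: eqP => [->|_]; first by split; [apply: openI => //;
    exact: (oV i).1|exists x].
  case: eqP => [->|_]; first by split; [apply: openI => //;
    exact: (oV j).1|exists y].
  by rewrite setIT.
- by move=> k z [/VU].
- move=> p; rewrite inE => /orP[/eqP->|pl] a b /=; last first.
    by move=> [Va _] [Vb _]; exact: (VF p).
  rewrite /W eqxx eq_sym (negPf ij) eqxx => -[_ Aa] [_ Bb].
  exact: (AB (a, b)).
Qed.

Lemma shrink_open_family (I : Type) (U : I -> set T) : open_family U ->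
  exists V, open_family V /\ forall i, closure (V i) `<=` U i.
Proof.
move=> oU; suff /choice[V VP] : forall i, exists V : set T,
    [/\ open V, V !=set0 & closure V `<=` U i].
  by exists V; split=> i; have [] := VP i.
move=> i; have [oi [x Ux]] := oU i.
by have [V [oV Vx VU]] := shrink_open cT hT oi Ux; exists V; split=> //;
  exists x.
Qed.

(** A level is a family over all of [seq bool], in which only the lists of length [n.+1] are
    separated; [take n s] is the parent of such a list. Finitely many pairs and indices [k] occur,
    so finitely many refinements suffice. *)
Lemma cantor_scheme_step n (U : seq bool -> set T) : open_family U ->
  exists V, [/\ open_family V, forall s, closure (V s) `<=` U (take n s) &
    forall (s t : n.+1.-tuple bool) k x y, s != t -> (k <= n)%N ->
      V s x -> V t y -> ~ F k (x, y)].
Proof.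
move=> oU.
have oU' : open_family (fun s => U (take n s)) by move=> s; exact: oU.
pose l := [seq (tval q.1.1, tval q.1.2, nat_of_ord q.2) |
  q <- enum {: n.+1.-tuple bool * n.+1.-tuple bool * 'I_n.+1} &
  q.1.1 != q.1.2].
have [|V [oV VU VF]] := @refine_open_family _ _ l oU'.
  by move=> p /mapP[q]; rewrite mem_filter => /andP[q12 _] ->.
have [W [oW WV]] := shrink_open_family oV; exists W; split=> //.
  by move=> s; exact: subset_trans (WV s) (VU s).
move=> s t k x y st kn /subset_closure/WV Vx /subset_closure/WV Vy.
apply: (VF (tval s, tval t, k)) => //.
apply/mapP; exists (s, t, Ordinal (kn : (k < n.+1)%N)) => //.
by rewrite mem_filter st mem_enum.
Qed.

(** Mycielski's independence theorem for countably many closed nowhere dense relations. The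
    intersection along a branch need not be a single point; any choice of a point in it works. *)
Lemma mycielski : [set: T] !=set0 ->
  exists f : (nat -> bool) -> T,
    forall a b, a <> b -> forall n, ~ F n (f a, f b).
Proof.
move=> T0.
have /choice[g gP] : forall p : nat * (seq bool -> set T),
    exists V, open_family p.2 ->
    [/\ open_family V, forall s, closure (V s) `<=` p.2 (take p.1 s) &
    forall (s t : p.1.+1.-tuple bool) k x y, s != t -> (k <= p.1)%N ->
      V s x -> V t y -> ~ F k (x, y)].
  move=> [n U]; have [oU|nU] := pselect (open_family U); last by exists U.
  by have [V VP] := cantor_scheme_step n oU; exists V.
pose U := fix U n := if n is m.+1 then g (m, U m) else fun=> setT.
have oU n : open_family (U n).
  elim: n => [|n IH]; first by move=> s; split=> //; exact: openT.
  by have [] := gP (n, U n) IH.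
have takeU (a : nat -> bool) n : closure (U n.+1 (mkseq a n.+1)) `<=` U n
  (mkseq a n).
  have [_ + _] := gP (n, U n) (oU n) => /(_ (mkseq a n.+1)) /=.
  by rewrite /mkseq -map_take take_iota (minn_idPl (leqnSn n)).
have /choice[f fP] : forall a : nat -> bool, exists x, forall n,
  U n (mkseq a n) x.
  move=> a; have [|||n|x xP] := @compact_nested T (fun n =>
    closure (U n (mkseq a n))).
  - exact: cT.
  - by move=> n; exact: closed_closure.
  - by move=> n; have [_ [x Ux]] := oU n (mkseq a n); exists x;
      exact: subset_closure.
  - by apply: subset_trans (takeU a n) _; exact: subset_closure.
  - by exists x => n; apply: takeU; exact: xP.
exists f => a b ab k.
have [m abm] : exists m, a m != b m.
  apply: contrapT => H; apply: ab; apply/funext => m.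
  by apply/eqP; apply: contrapT => /negP ?; apply: H; exists m.
(* At level [n.+1] the branches have split, as [m <= n], and [F k] is already avoided, as
   [k <= n]. *)
pose n := maxn m k.
have [_ _ nF] := gP (n, U n) (oU n).
apply: (nF [tuple of mkseq a n.+1] [tuple of mkseq b n.+1]).
- apply: contra abm => /eqP/(congr1 (fun s : n.+1.-tuple bool => nth true s m)).
  by rewrite /= !nth_mkseq ?ltnS ?leq_maxl // => ->.
- exact: leq_maxr.
- exact: (fP a n.+1).
- exact: (fP b n.+1).
Qed.

End CantorScheme.

(** * Analytic subgroups of compact groups *)

Section GroupLaw.
Variables (T : Type) (c : group_law T).
Local Notation "x ∗ y" := (lmul c x y) (at level 40, left associativity).
Local Notation "x ^v" := (linv c x) (at level 3, format "x ^v").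

Lemma lmulA x y z : x ∗ (y ∗ z) = x ∗ y ∗ z.
Proof. exact: (@mulgA (law_group c)). Qed.
Lemma lmul1g x : lone c ∗ x = x.
Proof. exact: (@mul1g (law_group c)). Qed.
Lemma lmulg1 x : x ∗ lone c = x.
Proof. exact: (@mulg1 (law_group c)). Qed.
Lemma lmulVg x : x^v ∗ x = lone c.
Proof. exact: (@mulVg (law_group c)). Qed.
Lemma lmulgV x : x ∗ x^v = lone c.
Proof. exact: (@mulgV (law_group c)). Qed.
Lemma lmulKg x y : x^v ∗ (x ∗ y) = y.
Proof. exact: (@mulKg (law_group c)). Qed.
Lemma lmulVKg x y : x ∗ (x^v ∗ y) = y.
Proof. exact: (@mulVKg (law_group c)). Qed.
Lemma lmulgK x y : y ∗ x ∗ x^v = y.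
Proof. exact: (@mulgK (law_group c)). Qed.
Lemma linvM x y : (x ∗ y)^v = y^v ∗ x^v.
Proof. exact: (@invgM (law_group c)). Qed.
Lemma lmulI x : injective (lmul c x).
Proof. exact: (@mulgI (law_group c)). Qed.

Definition is_subgroup (H : set T) : Prop :=
  [/\ H (lone c), forall x y, H x -> H y -> H (x ∗ y) & forall x, H x -> H x^v].

End GroupLaw.

Section SubgroupPred.
Variables (T : Type) (c : group_law T) (H : set T) (HP : is_subgroup c H).

(** The proof that [H] is a subgroup is an argument so that the closure instances can be attached to
    the predicate. *)
Definition subgroup_pred of is_subgroup c H : {pred law_group c} :=
  fun x => `[< H x >].

Fact subgroup_predM : mulg_closed (subgroup_pred HP).
Proof. by have [_ HM _] := HP; move=> x y /asboolP Hx /asboolP Hy;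
  apply/asboolP/HM. Qed.
Fact subgroup_pred1 : (1%g : law_group c) \in subgroup_pred HP.
Proof. by have [H1 _ _] := HP; apply/asboolP. Qed.
Fact subgroup_predV : invg_closed (subgroup_pred HP).
Proof. by have [_ _ HV] := HP; move=> x /asboolP Hx; apply/asboolP/HV. Qed.

HB.instance Definition _ := isMulClosed.Build (law_group c) (subgroup_pred HP)
  subgroup_predM.
HB.instance Definition _ := isMul1Closed.Build (law_group c) (subgroup_pred HP)
  subgroup_pred1.
HB.instance Definition _ := isInvClosed.Build (law_group c) (subgroup_pred HP)
  subgroup_predV.

Lemma subgroup_groupClosed :
  exists S : groupClosed (law_group c), forall x : T, (x \in S) = `[< H x >].
Proof. by exists (subgroup_pred HP : groupClosed _). Qed.
End SubgroupPred.

Lemma meager_preimage (S T : topologicalType) (f : S -> T) (B : set T) :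
  continuous f -> (forall p W, nbhs p W -> nbhs (f p) (f @` W)) ->
  meager B -> meager (f @^-1` B).
Proof.
move=> cf of_ [F FP BF]; exists (fun n => f @^-1` F n); last by move=> x /BF.
move=> n; have [cF iF] := FP n; split; first by apply: preimage_closed =>
  // ? _; exact: cf.
rewrite -subset0 => x /(of_ x) fx; suff : interior (F n) (f x) by rewrite iF.
by apply: filterS fx => _ [y Fy <-].
Qed.

Section TopologicalGroup.
Variables (T : topologicalType) (c : group_law T).
Hypothesis tc : topological_group c.
Local Notation "x ∗ y" := (lmul c x y) (at level 40, left associativity).
Local Notation "x ^v" := (linv c x) (at level 3, format "x ^v").

Lemma lmul_continuous (S : topologicalType) (f g : S -> T) :
  continuous f -> continuous g -> continuous (fun x => f x ∗ g x).
Proof.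
move=> cf cg x; apply: (@continuous2_cvg _ _ _ _ (nbhs x) _ f g (lmul c));
  last 2 first.
- exact: cf.
- exact: cg.
exact: (tc.1 (f x, g x)).
Qed.

Lemma linv_continuous (S : topologicalType) (f : S -> T) :
  continuous f -> continuous (fun x => (f x)^v).
Proof. by move=> cf x; apply: continuous_comp; [exact: cf|exact: tc.2]. Qed.

(** Pettis' argument: for [x] near the unit, [O] and its translate by the inverse of [x] meet in a
    nonempty open set. That set is nonmeager, so it contains some [z] with both [z] and [z ∗ x] in
    [H], and [x] is their quotient. *)
Lemma subgroup_comeager_open (H O : set T) : is_subgroup c H ->
  compact [set: T] -> hausdorff_space T ->
  open O -> O !=set0 -> meager (O `\` H) -> open H.
Proof.
move=> [H1 HM HV] cT hT oO [o Oo] mO.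
have cR x : continuous (fun z => z ∗ x) by apply: lmul_continuous;
  [exact: id_cont|exact: cst_cont].
have cL x : continuous (fun z => x ∗ z) by apply: lmul_continuous;
  [exact: cst_cont|exact: id_cont].
pose N := [set x | O (o ∗ x)].
have oN : open N by apply: (open_comp (f := fun x => o ∗ x)) => // x _;
  exact: cL.
have NH : N `<=` H.
  move=> x Nx; pose V := O `&` [set z | O (z ∗ x)].
  have oV : open V.
    by apply: openI => //; apply: (open_comp (f := fun z => z ∗ x)) => // z _;
      exact: cR.
  have mR : meager [set z | (O `\` H) (z ∗ x)].
    apply: (@meager_preimage _ _ (fun z => z ∗ x)) => // p W Wp.
    have : nbhs (p ∗ x) ((fun z => z ∗ x^v) @^-1` W).
      by apply: cR; rewrite lmulgK.
    apply: filterS => z Wz; exists (z ∗ x^v) => //.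
    by rewrite -lmulA lmulVg lmulg1.
  have : ~ meager V by apply: open_nonmeager => //; exists o.
  move=> nV; have [z [Vz [zH zxH]]] : exists z, V z /\ (H z /\ H (z ∗ x)).
    apply: contrapT => e; apply: nV; apply: meagerS (meagerU mO mR).
    move=> z [Oz Ozx]; have [Hz|nHz] := pselect (H z); last by left.
    by right; split=> // Hzx; apply: e; exists z.
  by rewrite -(lmulKg c z x); apply: HM => //; exact: HV.
rewrite openE => h Hh; rewrite /interior.
apply: (@filterS _ _ _ ((fun y => h^v ∗ y) @^-1` N)).
  by move=> y /NH Hy; rewrite -(lmulVKg c h y); exact: HM.
apply: cL; apply: open_nbhs_nbhs; split=> //.
by rewrite /N /= lmulVg lmulg1.
Qed.

(** The map [d] is continuous and open, so the closed nowhere dense sets covering [H] pull back to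
    closed nowhere dense relations. Points independent for all of these lie in distinct left
    cosets. *)
Lemma meager_subgroup_classes (H : set T) : compact [set: T] ->
  hausdorff_space T -> meager H ->
  exists f : (nat -> bool) -> T, forall a b, a <> b -> ~ H ((f a)^v ∗ f b).
Proof.
move=> cT hT [F FP HF].
pose d (p : T * T) := p.1^v ∗ p.2.
have cd : continuous d.
  by apply: lmul_continuous; [apply: linv_continuous => x;
    exact: cvg_fst|move=> x; exact: cvg_snd].
have od p W : nbhs p W -> nbhs (d p) (d @` W).
  move: p => [x y] Wp.
  have cz : continuous (fun z => (x, x ∗ z)).
    apply: pair_cont; first exact: cst_cont.
    by apply: lmul_continuous; [exact: cst_cont|exact: id_cont].
  have : nbhs (d (x, y)) ((fun z => (x, x ∗ z)) @^-1` W).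
    by apply: cz; rewrite /d /= lmulVKg.
  by apply: filterS => z Wz; exists (x, x ∗ z) => //; rewrite /d /= lmulKg.
have [||f fP] := @mycielski T (fun n => d @^-1` F n) cT hT _ _ (ex_intro _
  (lone c) I).
- by move=> n; apply: preimage_closed => [x _|]; [exact: cd|exact: (FP n).1].
- move=> n; rewrite -subset0 => p /(od p) dp; have [_ iF] := FP n.
  suff : interior (F n) (d p) by rewrite iF.
  by apply: filterS dp => _ [y Fy <-].
- by exists f => a b ab /HF[n _ Fn]; apply: (fP a b ab n).
Qed.

Lemma analytic_subgroup_dichotomy (H : set T) : compact [set: T] ->
  hausdorff_space T -> is_subgroup c H -> analytic H ->
  open H \/
  exists f : (nat -> bool) -> T, forall a b, a <> b -> ~ H ((f a)^v ∗ f b).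
Proof.
move=> cT hT HS [P cP HE]; have [mH|nmH] := pselect (meager H).
  by right; exact: meager_subgroup_classes.
left; rewrite HE in nmH; have [O [oO O0 mO]] := souslin_nonmeager cP nmH.
by apply: subgroup_comeager_open oO O0 _ => //; rewrite HE.
Qed.

End TopologicalGroup.

(** * Compact right topological semigroups *)

Section MkGroupLaw.
Variables (T : choiceType) (one : T) (inv : T -> T) (mul : T -> T -> T).
Hypotheses (mulA : associative mul) (mul1 : left_id one mul)
  (mulr1 : right_id one mul) (mulV : left_inverse one inv mul)
  (mulrV : right_inverse one inv mul).

(* An alias, lest the group structure become canonical on [T] itself. *)
Definition group_carrier of associative mul & left_id one mul & right_id one mul
  & left_inverse one inv mul & right_inverse one inv mul : Type := T.
Local Notation carrier := (group_carrier mulA mul1 mulr1 mulV mulrV).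

HB.instance Definition _ := Choice.on carrier.
HB.instance Definition _ :=
  @isGroup.Build carrier one inv mul mulA mul1 mulr1 mulV mulrV.

Definition mk_group_law : group_law T := Group.class (carrier : groupType).

Lemma lmul_mk : lmul mk_group_law = mul. Proof. by []. Qed.
Lemma linv_mk : linv mk_group_law = inv. Proof. by []. Qed.
End MkGroupLaw.

(** Zorn's lemma, used below for closed subsemigroups and for closed left ideals. It is available
    for unions of chains, hence the passage to complements within [A0]; compactness keeps the
    intersection of a chain nonempty. *)
Lemma minimal_closed (T : topologicalType) (Pr : set (set T)) (A0 : set T) :
  compact [set: T] ->
  (forall Fam : set (set T), Fam `<=` Pr -> Pr (\bigcap_(A in Fam) A)) ->
  closed A0 -> A0 !=set0 -> Pr A0 ->
  exists A, [/\ closed A, A !=set0, Pr A, A `<=` A0 &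
    forall B, closed B -> B !=set0 -> Pr B -> B `<=` A -> A `<=` B].
Proof.
move=> cT PrI cA0 A00 PA0.
pose good B := [/\ closed B, B !=set0 & Pr B].
pose Q : set (set T) := [set U | good (A0 `\` U)].
have [F FQ totF|U [[cU U0 PU] maxU]] := @Zorn_bigcup T Q; last first.
  exists (A0 `\` U); split=> // B cB B0 PB BU x [Ax Ux].
  apply: contrapT => Bx; apply: (maxU (~` B)).
    split; first by move=> y Uy By; case: (BU _ By).
    by move=> /(_ x Bx).
  suff e : A0 `\` ~` B = B by rewrite /Q /= e.
  apply/seteqP; split=> [y [_ /contrapT]//|y By].
  by have [Ay _] := BU _ By; split=> //; apply.
have [F0|F0] := pselect (F !=set0); last first.
  suff -> : \bigcup_(X in F) X = set0 by rewrite /Q /= setD0.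
  by rewrite -subset0 => x [X FX]; case: F0; exists X.
have E : A0 `\` \bigcup_(X in F) X = \bigcap_(B in [set A0 `\` X | X in F]) B.
  apply/seteqP; split=> [x [Ax nx] _ [X FX <-]|x xB].
    by split=> // Xx; apply: nx; exists X.
  split; first by case: F0 => X FX; have [] := xB _ (ex_intro2 _ _ X FX erefl).
  by move=> [X FX Xx]; have [_] := xB _ (ex_intro2 _ _ X FX erefl).
have gF : [set A0 `\` X | X in F] `<=` good by move=> _ [X /FQ + <-].
rewrite /Q /= E; split.
- by apply: closed_bigI => B /gF[].
- have FF : ProperFilter (filter_from F (fun X => A0 `\` X)).
    apply: filter_from_proper => [|X /FQ[]//].
    apply: filter_from_filter => // X Y FX FY.
    have [XY|YX] := totF _ _ FX FY.
      by exists Y => // x [Ax Yx]; split=> //; split=> // /XY.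
    by exists X => // x [Ax Xx]; split=> //; split=> // /YX.
  have [|x [_ xF]] := cT _ FF; first by case: F0 => X FX; exists X.
  exists x => B BF; have [cB _ _] := gF _ BF; apply: cB => W Wx;
    apply: xF => //.
  by case: BF => X FX <-; exists X.
- by apply: PrI => B /gF[].
Qed.

Section EllisSemigroup.
Variables (S : topologicalType) (op : S -> S -> S).
Hypotheses (cS : compact [set: S]) (hS : hausdorff_space S).
Hypotheses (opA : associative op) (opr : forall h, continuous (op^~ h)).
Local Notation "x ∗ y" := (op x y) (at level 40, left associativity).

Lemma closed_image_opr (A : set S) h : closed A -> closed [set x ∗ h | x in A].
Proof.
move=> cA; apply: compact_closed => //.
apply: continuous_compact; first exact/continuous_subspaceT/opr.
exact: subclosed_compact cS _.
Qed.

(** The Ellis-Numakura lemma: in a minimal closed subsemigroup [E], minimality yields [E ∗ e = E],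
    and applied again to the [x] in [E] with [x ∗ e = e] it yields [e ∗ e = e]. Both sets are closed
    because right translations are continuous. *)
Lemma ellis_idempotent (N : set S) : closed N -> N !=set0 ->
  (forall x y, N x -> N y -> N (x ∗ y)) -> exists2 e, N e & e ∗ e = e.
Proof.
move=> cN N0 NM.
pose sub : set (set S) := [set A | forall x y, A x -> A y -> A (x ∗ y)].
have [Fam Fs|E [cE [e Ee] EM EN minE]] := minimal_closed cS _ cN N0 (NM : sub
  N).
  by move=> x y xF yF A FA; apply: Fs => //; [exact: xF|exact: yF].
have [a Ea ae] : [set x ∗ e | x in E] e.
  apply: (minE [set x ∗ e | x in E]) => //.
  - exact: closed_image_opr.
  - by exists (e ∗ e); exists e.
  - move=> _ _ [x Ex <-] [y Ey <-]; exists (x ∗ e ∗ y); last by rewrite !opA.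
    exact: EM _ _ (EM _ _ Ex Ee) Ey.
  - by move=> _ [x Ex <-]; exact: EM.
pose B := E `&` [set x | x ∗ e = e].
have Be : B e.
  apply: (minE B) => //.
  - apply: closedI => //.
    have -> : [set x | x ∗ e = e] = [set x | [set e] (x ∗ e)] by [].
    apply: closed_comp_cont; first exact: opr.
    exact/accessible_closed_set1/hausdorff_accessible.
  - by exists a.
  - by move=> x y [Ex xe] [Ey ye]; split; [exact: EM|rewrite /= -opA ye].
  - by move=> x [].
by exists e; [exact: EN|case: Be].
Qed.

(** By minimality [M ∗ f = M] for every [f] in [M], which makes [u] a right unit of [M] and provides
    left inverses. On [uM] the function [iv] is the group inverse; elsewhere the statement leaves
    its values open. *)
Lemma ellis_minimal_ideal : [set: S] !=set0 ->
  exists (M : set S) (u : S) (iv : S -> S),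
  [/\ closed M, M u, forall s a, M a -> M (s ∗ a), forall f, M f -> f ∗ u = f &
    forall x, M x -> u ∗ x = x ->
      [/\ M (iv x), u ∗ iv x = iv x, iv x ∗ x = u & x ∗ iv x = u]].
Proof.
move=> S0.
pose ideal : set (set S) := [set A | forall s a, A a -> A (s ∗ a)].
have [Fam Fs|M [cM M0 IM _ minM]] := @minimal_closed S ideal setT cS _
  (@closedT S) S0 (fun s a t => t).
  by move=> s a aF A FA; apply: Fs => //; exact: aF.
have [u Mu uu] := ellis_idempotent cM M0 (fun x y _ My => IM x y My).
have MM f : M f -> M `<=` [set x ∗ f | x in M].
  move=> Mf; apply: minM.
  - exact: closed_image_opr.
  - by exists (u ∗ f); exists u.
  - by move=> s _ [a Ma <-]; exists (s ∗ a); [exact: IM|rewrite opA].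
  - by move=> _ [a Ma <-]; exact: IM.
have fu f : M f -> f ∗ u = f.
  by move=> Mf; have [x _ <-] := MM u Mu f Mf; rewrite -opA uu.
have linv x : M x -> exists y, [/\ M y, u ∗ y = y & y ∗ x = u].
  move=> Mx; have [k Mk kx] := MM x Mx u Mu.
  by exists (u ∗ k); split; [exact: IM|rewrite opA uu|rewrite -opA kx].
have /choice[iv ivP] : forall x, exists y, M x -> [/\ M y,
  u ∗ y = y & y ∗ x = u].
  by move=> x; have [/linv[y yP]|nM] := pselect (M x); [exists y|exists x].
exists M, u, iv; split=> // x Mx ux.
have [My uy yx] := ivP x Mx; split=> //.
(* A left inverse of [iv x] exists as well, and this makes [iv x] a right inverse of [x]. *)
have [Mz uz zy] := ivP _ My.
by rewrite -[X in X ∗ _]ux -{1}zy -[iv (iv x) ∗ _ ∗ _]opA yx fu.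
Qed.

End EllisSemigroup.

(** * Hausdorff reflection of a semitopological group *)

Lemma hausdorff_open_map (S T : topologicalType) (f : S -> T) :
  (forall y, exists x, f x = y) ->
  (forall U, open U -> open (f @` U)) ->
  (forall x y, f x <> f y -> exists U V : set S, [/\ open U, open V, U x, V y &
    forall a b, U a -> V b -> f a <> f b]) ->
  hausdorff_space T.
Proof.
move=> sf of_ sepf p q; have [x <-] := sf p; have [y <-] := sf q => clxy.
apply: contrapT => /sepf[U [V [oU oV Ux Vy UV]]].
have [||_ [[a Ua <-] [b Vb /esym]]] := clxy (f @` U) (f @` V).
- by apply: open_nbhs_nbhs; split; [exact: of_|exists x].
- by apply: open_nbhs_nbhs; split; [exact: of_|exists y].
exact: UV.
Qed.

Lemma clsP (X : topologicalType) (E : equiv_rel X) x y :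
  cls E x = cls E y <-> E x y.
Proof.
split=> [xy|/eqmodP//].
by have /eqmodP : x = y %[mod {eq_quot E}] := xy.
Qed.

Lemma cls_repr (X : topologicalType) (E : equiv_rel X) (q : quot E) :
  cls E (repr q) = q.
Proof. exact: reprK. Qed.

Section HausdorffReflection.
Variables (T : topologicalType) (c : group_law T).
Hypotheses (contL : forall a, continuous (lmul c a)).
Hypotheses (contR : forall a, continuous ((lmul c)^~ a)).
Local Notation "x ∗ y" := (lmul c x y) (at level 40, left associativity).
Local Notation "x ^v" := (linv c x) (at level 3, format "x ^v").

Definition inseparable (x y : T) : Prop := forall U V : set T,
  open U -> open V -> U x -> V y -> U `&` V !=set0.

(** Inseparability is not transitive in a general space. Here a right translation carries a
    neighbourhood of [z] to one of [y], so that [x] and [y] produce [v], and left translation by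
    [v ∗ y^v] brings both open sets back to [y] and [z]. Continuity is needed on both sides. *)
Lemma inseparable_trans x y z :
  inseparable x y -> inseparable y z -> inseparable x z.
Proof.
move=> xy yz U V oU oV Ux Vz.
have [v [Uv Vv]] : U `&` [set v | V (v ∗ (y^v ∗ z))] !=set0.
  apply: xy => //; first exact: (open_comp_cont (@contR (y^v ∗ z)) oV).
  by rewrite /= lmulVKg.
have cv : continuous (fun w => v ∗ y^v ∗ w) by exact: contL.
have [w [Uw Vw]] : [set w | U (v ∗ y^v ∗ w)] `&` [set w | V (v ∗ y^v ∗ w)]
  !=set0.
  apply: yz; try exact: (open_comp_cont cv).
  - by rewrite /= -lmulA lmulVg lmulg1.
  - by rewrite /= -lmulA.
by exists (v ∗ y^v ∗ w).
Qed.

Lemma inseparableMl a x y : inseparable x y -> inseparable (a ∗ x) (a ∗ y).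
Proof.
move=> xy U V oU oV Ux Vy.
have [|||//|z [Uz Vz]] := xy [set z | U (a ∗ z)] [set z | V (a ∗ z)].
- exact: (open_comp_cont (@contL a)).
- exact: (open_comp_cont (@contL a)).
- exact: Ux.
- by exists (a ∗ z).
Qed.

Lemma inseparableMr a x y : inseparable x y -> inseparable (x ∗ a) (y ∗ a).
Proof.
move=> xy U V oU oV Ux Vy.
have [|||//|z [Uz Vz]] := xy [set z | U (z ∗ a)] [set z | V (z ∗ a)].
- exact: (open_comp_cont (@contR a)).
- exact: (open_comp_cont (@contR a)).
- exact: Ux.
- by exists (z ∗ a).
Qed.

Definition insep_rel : rel T := fun x y => `[< inseparable x y >].

Lemma insep_rel_equiv : equiv_class_of insep_rel.
Proof.
rewrite /insep_rel; split=> [x|x y|y x z].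
- by apply/asboolP => U V _ _ Ux Vx; exists x.
- by apply/asboolP/asboolP => xy U V oU oV Ux Vy; rewrite setIC; exact: xy.
- by move=> /asboolP xy /asboolP yz; apply/asboolP; exact: inseparable_trans yz.
Qed.

Definition insep_equiv : equiv_rel T := EquivRelPack insep_rel_equiv.

Definition hausdorff_reflection : topologicalType := quot insep_equiv.
Local Notation K := hausdorff_reflection.
Definition reflect_pi (x : T) : K := cls insep_equiv x.
Local Notation pi := reflect_pi.

Lemma reflect_piP x y : pi x = pi y <-> inseparable x y.
Proof.
by split=> [/clsP/asboolP//|xy]; apply/clsP/asboolP.
Qed.

Lemma reflect_pi_surj k : pi (repr k) = k.
Proof. exact: reprK. Qed.

Lemma reflect_pi_cont : continuous pi.
Proof. exact: pi_continuous. Qed.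

Lemma repr_piP x : inseparable (repr (pi x)) x.
Proof. by apply/reflect_piP; rewrite reflect_pi_surj. Qed.

Lemma inseparable_sym x y : inseparable x y -> inseparable y x.
Proof. by move=> /reflect_piP xy; apply/reflect_piP. Qed.

Lemma pi_mul x y x' y' :
  pi x = pi x' -> pi y = pi y' -> pi (x ∗ y) = pi (x' ∗ y').
Proof.
move=> /reflect_piP xx /reflect_piP yy; apply/reflect_piP.
exact: (@inseparable_trans _ (x' ∗ y) _ (@inseparableMr y _ _ xx)
  (@inseparableMl x' _ _ yy)).
Qed.

Lemma pi_inv x x' : pi x = pi x' -> pi x^v = pi x'^v.
Proof.
move=> /reflect_piP xx; apply/reflect_piP.
have := @inseparableMr x^v _ _ (@inseparableMl x'^v _ _ (inseparable_sym xx)).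
by rewrite lmulVg lmul1g -lmulA lmulgV lmulg1.
Qed.

Let mulK (k l : K) : K := pi (repr k ∗ repr l).
Let invK (k : K) : K := pi (repr k)^v.
Let oneK : K := pi (lone c).

Let piM x y : mulK (pi x) (pi y) = pi (x ∗ y).
Proof. by apply: pi_mul; rewrite reflect_pi_surj. Qed.
Let piV x : invK (pi x) = pi x^v.
Proof. by apply: pi_inv; rewrite reflect_pi_surj. Qed.

Let mulKA : associative mulK.
Proof.
by move=> k l m; rewrite -(reflect_pi_surj k) -(reflect_pi_surj l)
  -(reflect_pi_surj m) !piM lmulA.
Qed.
Let mul1K : left_id oneK mulK.
Proof. by move=> k; rewrite -(reflect_pi_surj k) piM lmul1g. Qed.
Let mulK1 : right_id oneK mulK.
Proof. by move=> k; rewrite -(reflect_pi_surj k) piM lmulg1. Qed.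
Let mulVK : left_inverse oneK invK mulK.
Proof. by move=> k; rewrite -(reflect_pi_surj k) piV piM lmulVg. Qed.
Let mulKV : right_inverse oneK invK mulK.
Proof. by move=> k; rewrite -(reflect_pi_surj k) piV piM lmulgV. Qed.

Definition reflect_law : group_law K := mk_group_law mulKA mul1K mulK1 mulVK
  mulKV.

Lemma reflect_piM x y : pi (x ∗ y) = lmul reflect_law (pi x) (pi y).
Proof. by rewrite lmul_mk piM. Qed.
Lemma reflect_piV x : pi x^v = linv reflect_law (pi x).
Proof. by rewrite linv_mk piV. Qed.

(** The saturation of [U] is a union of right translates of [U], by the elements inseparable from
    the unit. Openness of the quotient map is what makes the quotient by inseparability
    Hausdorff. *)
Lemma reflect_pi_open U : open U -> open (pi @` U).
Proof.
move=> oU; suff : open (pi @^-1` (pi @` U)) by [].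
have -> : pi @^-1` (pi @` U) =
    \bigcup_(n in inseparable (lone c)) [set x | U (x ∗ n)].
  apply/seteqP; split=> [x [y Uy /reflect_piP yx]|x [n n1 Uxn]].
    exists (x^v ∗ y); last by rewrite /= lmulVKg.
    by have := @inseparableMl x^v _ _ (inseparable_sym yx); rewrite lmulVg.
  exists (x ∗ n) => //; apply/reflect_piP.
  by have := @inseparableMl x _ _ (inseparable_sym n1); rewrite lmulg1.
by apply: bigcup_open => n _; exact: (open_comp_cont (@contR n) oU).
Qed.

Lemma reflection_hausdorff : hausdorff_space K.
Proof.
apply: (@hausdorff_open_map _ _ pi).
- by move=> k; exists (repr k); exact: reflect_pi_surj.
- exact: reflect_pi_open.
- move=> x y nxy; apply: contrapT => H; apply: nxy; apply/reflect_piP.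
  move=> U V oU oV Ux Vy; apply: contrapT => UV; apply: H.
  exists U, V; split=> // a b Ua Vb /reflect_piP ab.
  by apply: UV; exact: ab.
Qed.

Lemma reflection_compact : compact [set: T] -> compact [set: K].
Proof.
move=> cT; have -> : [set: K] = pi @` setT.
  by apply/seteqP; split=> // k _; exists (repr k) => //;
    exact: reflect_pi_surj.
by apply: continuous_compact => //; exact/continuous_subspaceT/reflect_pi_cont.
Qed.

End HausdorffReflection.

(** * The tau-topology on the Ellis group *)

Section TauTopology.
Variables (S : topologicalType) (op : S -> S -> S) (M : set S) (u : S).
Local Notation "x ∗ y" := (op x y) (at level 40, left associativity).

(** The group [uM], under a name of its own so that it receives the tau-topology and not the
    subspace topology of [set_type]. *)
Definition ellis_group : Type := set_type [set x | M x /\ u ∗ x = x].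
Local Notation L := ellis_group.

HB.instance Definition _ := Choice.on L.

Definition elem (x : L) : S := val x.

Lemma elem_inj : injective elem.
Proof. exact: val_inj. Qed.

Lemma elemP (x : L) : M (elem x) /\ u ∗ elem x = elem x.
Proof. by have := set_valP x. Qed.

(* The complements of the sets [A] such that [u o A], the set of limits of
   products [s * a] with [s -> u] and [a] in [A], meets [uM] inside [A]. *)
Definition tau_open (U : set L) : Prop := forall x, U x ->
  exists V W : set S, [/\ nbhs u V, nbhs (elem x) W &
    forall s a, V s -> W (s ∗ elem a) -> U a].

Fact tau_openT : tau_open setT.
Proof. by move=> x _; exists setT, setT; split=> //; exact: filterT. Qed.

Fact tau_openI : setI_closed tau_open.
Proof.
move=> A B oA oB x [/oA[V [W [uV xW VW]]] /oB[V' [W' [uV' xW' VW']]]].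
exists (V `&` V'), (W `&` W'); split; try exact: filterI.
by move=> s a [Vs V's] [Wa W'a]; split; [exact: VW Vs Wa|exact: VW' V's W'a].
Qed.

Fact tau_open_bigU (I : Type) (f : I -> set L) :
  (forall i, tau_open (f i)) -> tau_open (\bigcup_i f i).
Proof.
move=> of_ x [i _ /of_[V [W [uV xW VW]]]]; exists V, W; split=> // s a Vs Wa.
by exists i => //; exact: VW Vs Wa.
Qed.

HB.instance Definition _ := isOpenTopological.Build L tau_openT tau_openI
  tau_open_bigU.

Lemma tau_openE (U : set L) : open U = tau_open U.
Proof. by []. Qed.

End TauTopology.
Arguments elem {S op M u}.

Section EllisGroup.
Variables (S : topologicalType) (op : S -> S -> S) (D : set S).
Hypotheses (cS : compact [set: S]) (hS : hausdorff_space S).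
Hypotheses (opA : associative op) (opr : forall h, continuous (op^~ h)).
Hypotheses (opl : forall g, D g -> continuous (op g)) (dD : dense D).
Variables (M : set S) (u : S) (iv : S -> S).
Hypotheses (cM : closed M) (Mu : M u).
Local Notation "x ∗ y" := (op x y) (at level 40, left associativity).
Hypotheses (IM : forall s a, M a -> M (s ∗ a)) (Mfu : forall f, M f ->
  f ∗ u = f).
Hypothesis ivP : forall x, M x -> u ∗ x = x ->
  [/\ M (iv x), u ∗ iv x = iv x, iv x ∗ x = u & x ∗ iv x = u].
Local Notation L := (ellis_group op M u).

Lemma nbhs_dense (A : set S) (p : S) : nbhs p A -> exists2 g, D g & A g.
Proof.
move=> pA; have [|g [Ag Dg]] := dD (O := A°) _ (open_interior A).
  by exists p; exact: nbhs_singleton (nbhs_interior pA).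
by exists g => //; exact: interior_subset.
Qed.

Lemma nbhs_opr h s (W : set S) :
  nbhs (s ∗ h) W -> nbhs s [set t | W° (t ∗ h)].
Proof. by move=> /nbhs_interior; exact: (@opr h s). Qed.

Let uu : u ∗ u = u. Proof. exact: Mfu. Qed.

Definition to_ellis (x : S) (h : M x /\ u ∗ x = x) : L :=
  SigSub (mem_set (h : [set x | M x /\ u ∗ x = x] x)).

Let rho_proof a : M (u ∗ (a ∗ u)) /\ u ∗ (u ∗ (a ∗ u)) = u ∗ (a ∗ u).
Proof. by split; [apply: IM; exact: IM|rewrite opA uu]. Qed.
Definition rho (a : S) : L := to_ellis (rho_proof a).

Lemma elem_rho a : elem (rho a) = u ∗ (a ∗ u). Proof. by []. Qed.
Lemma elem_rhoM a : M a -> elem (rho a) = u ∗ a.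
Proof. by move=> Ma; rewrite elem_rho Mfu. Qed.

Lemma rho_elem x : rho (elem x) = x.
Proof. by apply: elem_inj; have [Mx ux] := elemP x; rewrite elem_rhoM. Qed.

Let one : L := rho u.
Let mul (x y : L) : L := rho (elem x ∗ elem y).
Let inv (x : L) : L := rho (iv (elem x)).

Let elem_one : elem one = u. Proof. by rewrite elem_rhoM. Qed.
Let elem_mul x y : elem (mul x y) = elem x ∗ elem y.
Proof.
have [[_ ux] [My _]] := (elemP x, elemP y).
by rewrite elem_rhoM; [rewrite opA ux|exact: IM].
Qed.
Let elem_inv x : elem (inv x) = iv (elem x).
Proof. by have [Mx ux] := elemP x; have [Mi ui _ _] := ivP Mx ux;
  rewrite elem_rhoM. Qed.

Let mulA : associative mul.
Proof. by move=> x y z; apply: elem_inj; rewrite !elem_mul opA. Qed.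
Let mul1 : left_id one mul.
Proof. by move=> x; apply: elem_inj; rewrite elem_mul elem_one (elemP x).2. Qed.
Let mulr1 : right_id one mul.
Proof. by move=> x; apply: elem_inj; rewrite elem_mul elem_one (Mfu (elemP
  x).1). Qed.
Let mulV : left_inverse one inv mul.
Proof.
move=> x; apply: elem_inj; rewrite elem_mul elem_one elem_inv.
by have [Mx ux] := elemP x; have [] := ivP Mx ux.
Qed.
Let mulrV : right_inverse one inv mul.
Proof.
move=> x; apply: elem_inj; rewrite elem_mul elem_one elem_inv.
by have [Mx ux] := elemP x; have [] := ivP Mx ux.
Qed.

Definition ellis_law : group_law L := mk_group_law mulA mul1 mulr1 mulV mulrV.
Local Notation lm := (lmul ellis_law).
Local Notation li := (linv ellis_law).

Lemma elemM x y : elem (lm x y) = elem x ∗ elem y. Proof. exact: elem_mul. Qed.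
Lemma elem1 : elem (lone ellis_law) = u. Proof. exact: elem_one. Qed.
Lemma elemVl x : elem (li x) ∗ elem x = u.
Proof. by rewrite -elemM lmulVg elem1. Qed.
Lemma elemVr x : elem x ∗ elem (li x) = u.
Proof. by rewrite -elemM lmulgV elem1. Qed.

(** Points of [uM] that converge to [a] in [S] converge to [u ∗ a] in the tau-topology. Left
    multiplication by [u] is not continuous, but a [g] in [D] close to [u] already sends [a] into
    [W], and left multiplication by [g] is continuous. *)
Lemma tau_open_nbhs (U : set L) a : M a -> open U -> U (rho a) ->
  nbhs a [set b | forall y : L, elem y = b -> U y].
Proof.
move=> Ma oU /oU[V [W [uV aW VW]]]; rewrite elem_rhoM // in aW.
have [g Dg [Vg Wg]] : exists2 g, D g & (V `&` [set s | W° (s ∗ a)]) g.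
  by apply: (@nbhs_dense _ u); apply: filterI => //; apply: opr;
    exact: nbhs_interior.
have : nbhs a (op g @^-1` W) by apply: opl.
by apply: filterS => b Wb y yb; apply: (VW g) => //; rewrite yb.
Qed.

Lemma tau_compact : compact [set: L].
Proof.
move=> F FF _; have [|a [_ aF]] := cS (F := elem @ F); first exact: filterT.
have Ma : M a.
  have FM : F (elem @^-1` M) by apply: filterE => x; exact: (elemP x).1.
  by apply: cM => W Wa; exact: (aF M W FM Wa).
exists (rho a); split=> // A B FA; rewrite nbhsE => -[U [oU Ua] UB].
have FA' : F (elem @^-1` [set elem x | x in A]).
  by apply: filterS FA => x Ax; exists x.
have [_ [[y Ay <-] Uy]] := aF _ _ FA' (tau_open_nbhs Ma oU Ua).
by exists y; split=> //; apply/UB/Uy.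
Qed.

Lemma tau_contR h : continuous (lm^~ h).
Proof.
apply/continuousP => U; rewrite !tau_openE => oU x Ux.
have [V [W [uV xW VW]]] := oU _ Ux.
exists V, [set s | W (s ∗ elem h)]; split=> //; first by apply: opr;
  rewrite -elemM.
by move=> s a Vs /= Wa; apply: (VW s) => //; rewrite elemM opA.
Qed.

(* [s * a] near [x] with [s] near [u] gives [g * s * h^-1 * (h * a)] near [h * x]
   for [g] in [D] near [h]; only left translations by [D] are continuous. *)
Lemma tau_contL h : continuous (lm h).
Proof.
apply/continuousP => U; rewrite !tau_openE => oU x Ux.
have [V [W [uV xW VW]]] := oU _ Ux.
have [g Dg [Vg Wg]] : exists2 g, D g &
    ([set g | V° (g ∗ elem (li h))] `&` [set g | W° (g ∗ elem x)]) g.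
  apply: (@nbhs_dense _ (elem h)); apply: filterI; apply: opr;
    apply: nbhs_interior.
    by rewrite elemVr.
  by rewrite -elemM.
exists [set s | V (g ∗ s ∗ elem (li h))], [set s | W (g ∗ s)]; split.
- have /opr : nbhs (g ∗ u ∗ elem (li h)) V.
    by rewrite -opA (elemP (li h)).2.
  by apply: (opl Dg).
- exact: (opl Dg).
- move=> s a Vs Wa; apply: (VW _ _ Vs).
  by rewrite -(opA (g ∗ s)) -elemM lmulKg -opA.
Qed.

Local Notation K := (hausdorff_reflection tau_contL tau_contR).
Local Notation piL := (reflect_pi tau_contL tau_contR).
Local Notation cK := (reflect_law tau_contL tau_contR).

Lemma ellis_hausdorff : hausdorff_space K.
Proof. exact: reflection_hausdorff. Qed.
Lemma ellis_compact : compact [set: K].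
Proof. exact: (reflection_compact tau_compact). Qed.

Definition ellis_hull : topologicalType := set_type (closure (range (@elem S op
  M u))).
Local Notation C := ellis_hull.
Definition hull_val (x : C) : S := set_val x.
Definition hull_pi (x : C) : K := piL (rho (hull_val x)).

Lemma hull_val_cont : continuous hull_val.
Proof. exact: initial_continuous. Qed.

Lemma hull_valP (x : C) : closure (range (@elem S op M u)) (hull_val x).
Proof. exact: set_valP. Qed.

Lemma hull_valM (x : C) : M (hull_val x).
Proof.
have RM : range (@elem S op M u) `<=` M by move=> _ [y _ <-];
  exact: (elemP y).1.
exact/cM/(closureS RM)/hull_valP.
Qed.

Definition to_hull (x : L) : C :=
  SigSub (mem_set (subset_closure (imageT elem x))).

Lemma hull_val_to_hull x : hull_val (to_hull x) = elem x. Proof. by []. Qed.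
Lemma hull_pi_to_hull x : hull_pi (to_hull x) = piL x.
Proof. by rewrite /hull_pi hull_val_to_hull rho_elem. Qed.

(** The neighbourhoods of [tau_open_nbhs] control only the points of [uM]. These are dense in [C],
    so the remaining points are sent into the closure of [O1], and the regularity of [K] absorbs the
    closure. *)
Lemma hull_pi_cont : continuous hull_pi.
Proof.
move=> x O; rewrite nbhsE => -[O0 [oO0 O0x] O0O].
have [O1 [oO1 O1x clO1]] := shrink_open ellis_compact ellis_hausdorff oO0 O0x.
have pull O' (y : C) : open O' -> O' (hull_pi y) ->
    nbhs (hull_val y) [set b | forall z : L, elem z = b -> O' (piL z)].
  move=> oO' O'y; apply: (@tau_open_nbhs (piL @^-1` O')) => //;
    first exact: hull_valM.
have xN : nbhs x [set y : C | nbhs (hull_val y)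
    [set b | forall z : L, elem z = b -> O1 (piL z)]].
  exact: (@hull_val_cont x _ (nbhs_interior (pull _ _ oO1 O1x))).
suff : nbhs x (hull_pi @^-1` O) by [].
apply: filterS xN => y Ny.
apply/O0O/clO1 => B; rewrite nbhsE => -[B0 [oB0 B0y] B0B].
have [_ [[z _ <-] [Nz Bz]]] := @hull_valP y _ (filterI Ny (pull _ _ oB0 B0y)).
by exists (piL z); split; [exact: Nz|apply: B0B; exact: Bz].
Qed.

Lemma hull_compact : compact [set: C].
Proof.
apply: compact_set_type; apply: subclosed_compact cS _ => //.
exact: closed_closure.
Qed.

Definition mul_graph : set (C * C * C) :=
  closure [set p | exists x y : L, p = (to_hull x, to_hull y,
    to_hull (lm x y))].

(* Joint continuity of the product of [K] comes from this inclusion, which makes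
   Ellis' joint continuity theorem unnecessary. *)
Lemma mul_graph_pi a b d : mul_graph (a, b, d) ->
  hull_pi d = lmul cK (hull_pi a) (hull_pi b).
Proof.
move=> abd.
have [Ma [Mb Md]] := (conj (hull_valM a) (conj (hull_valM b) (hull_valM d))).
pose al := rho (hull_val a).
suff : inseparable (lm (li al) (rho (hull_val d))) (rho (hull_val b)).
  move=> /(reflect_piP tau_contL tau_contR) e.
  rewrite /hull_pi -reflect_piM; rewrite -/al.
  have := pi_mul (c := ellis_law) (contL := tau_contL) (contR :=
    tau_contR) (erefl (piL al)) e.
  by rewrite lmulVKg.
have ea : elem (li al) ∗ hull_val a = u.
  have -> : elem (li al) ∗ hull_val a = elem (li al) ∗ (u ∗ hull_val a).
    by rewrite opA (Mfu (elemP (li al)).1).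
  by rewrite -elem_rhoM // elemVl.
have ed : elem (lm (li al) (rho (hull_val d))) = elem (li al) ∗ hull_val d.
  by rewrite elemM elem_rhoM // opA (Mfu (elemP (li al)).1).
move=> O O' + oO' + O'b; rewrite tau_openE => /[apply] -[V [W [uV]]].
rewrite ed => dW VW.
have Nb := tau_open_nbhs Mb oO' O'b.
(* With [g] near the inverse of [al], every triple [(x, y, x ∗ y)] close to [(a, b, d)] has [g ∗ x]
   near [u] and [g ∗ (x ∗ y)] in [W]. So the definition of tau-openness puts [y] into [O], while
   closeness to [b] puts it into [O']. *)
have [g Dg [Vg Wg]] : exists2 g, D g &
    ([set g | V° (g ∗ hull_val a)] `&` [set g | W° (g ∗ hull_val d)]) g.
  apply: (@nbhs_dense _ (elem (li al))); apply: filterI; apply: opr;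
    apply: nbhs_interior => //.
  by rewrite ea.
pose A : set C := [set x | V (g ∗ hull_val x)].
pose B : set C := [set y | forall z : L, elem z = hull_val y -> O' z].
pose E : set C := [set z | W (g ∗ hull_val z)].
have aA : nbhs a A by exact: (@hull_val_cont a _ (opl Dg Vg)).
have bB : nbhs b B by exact: (@hull_val_cont b _ Nb).
have dE : nbhs d E by exact: (@hull_val_cont d _ (opl Dg Wg)).
have [|_ [[x [y ->]] [[/= Ax By] Ez]]] := abd ((A `*` B) `*` E).
  by exists (A `*` B, E) => //; split=> //; exists (A, B).
exists y; split; last exact: By.
apply: (VW (g ∗ elem x)) => //.
by rewrite -opA -elemM.
Qed.

Lemma to_hull_mul_graph x y : mul_graph (to_hull x, to_hull y,
  to_hull (lm x y)).
Proof. by apply: subset_closure; exists x, y. Qed.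

(** A closed graph argument: the preimage of a closed set under the product is the image of a closed
    part of the compact [mul_graph]. For the inverse, the part lying over the unit is used. *)
Lemma ellis_topological_group : topological_group cK.
Proof.
have c1 : continuous (fun p : C * C * C => hull_pi p.1.1).
  apply: comp_cont hull_pi_cont => p.
  by apply: cvg_comp; [exact: cvg_fst|exact: cvg_fst].
have c2 : continuous (fun p : C * C * C => hull_pi p.1.2).
  apply: comp_cont hull_pi_cont => p.
  by apply: cvg_comp; [exact: cvg_fst|exact: cvg_snd].
have c3 : continuous (fun p : C * C * C => hull_pi p.2).
  by apply: comp_cont hull_pi_cont => p; exact: cvg_snd.
have cC3 : compact [set: C * C * C].
  by apply: compactT_setX; [apply: compactT_setX|]; exact: hull_compact.
have gr : closed mul_graph by exact: closed_closure.
split.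
- apply/continuous_closedP => B cB.
  have -> : (fun xy => lmul cK xy.1 xy.2) @^-1` B =
      (fun p : C * C * C => (hull_pi p.1.1, hull_pi p.1.2)) @`
      (mul_graph `&` [set p | B (hull_pi p.2)]).
    apply/seteqP; split=> [[k l] /= Bkl|_ [[[a b] d] [/mul_graph_pi e Bd] <-]]
      /=.
      exists (to_hull (repr k), to_hull (repr l),
        to_hull (lm (repr k) (repr l))).
        split; first exact: to_hull_mul_graph.
        by rewrite /= hull_pi_to_hull reflect_piM !reflect_pi_surj.
      by rewrite /= !hull_pi_to_hull !reflect_pi_surj.
    by rewrite -e.
  apply: closed_map_compact => //; first
    exact/hausdorff_prod/ellis_hausdorff/ellis_hausdorff.
    exact: pair_cont.
  by apply: closedI => //; exact: closed_comp_cont c3 cB.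
- apply/continuous_closedP => B cB.
  have -> : linv cK @^-1` B =
      (fun p : C * C * C => hull_pi p.1.1) @`
      (mul_graph `&` ([set p | B (hull_pi p.1.2)] `&` [set p | [set lone cK]
        (hull_pi p.2)])).
    apply/seteqP; split=> [k /= Bk|_ [[[a b] d] [/mul_graph_pi e [Bb /= d1]]
      <-]] /=.
      exists (to_hull (repr k), to_hull (li (repr k)),
        to_hull (lm (repr k) (li (repr k)))).
        split; first exact: to_hull_mul_graph.
        by rewrite /= !hull_pi_to_hull lmulgV reflect_piV reflect_pi_surj.
      by rewrite /= hull_pi_to_hull reflect_pi_surj.
    by rewrite -[linv cK _](lmulg1 cK) -d1 e lmulKg.
  apply: closed_map_compact => //; first exact: ellis_hausdorff.
  apply: closedI => //; apply: closedI; first exact: closed_comp_cont c2 cB.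
  apply: closed_comp_cont c3 _.
  exact/accessible_closed_set1/hausdorff_accessible/ellis_hausdorff.
Qed.

(** * Maps on [S] that respect limits of products *)

Section Hom.
Variables (Q : Type) (q : group_law Q) (r : S -> Q).
Hypothesis rP : forall a b d : S,
  (forall A B E : set S, nbhs a A -> nbhs b B -> nbhs d E ->
    exists x y, [/\ A x, B y & E (x ∗ y)]) ->
  r d = lmul q (r a) (r b).

Lemma homM a b : r (a ∗ b) = lmul q (r a) (r b).
Proof.
apply: rP => A B E aA bB abE.
have [x [Ax Ex]] : exists x, A x /\ E° (x ∗ b).
  have [x _ [Ax Ex]] := nbhs_dense (filterI aA (nbhs_opr abE)).
  by exists x.
by exists x, b; split=> //; [exact: nbhs_singleton bB|exact: interior_subset].
Qed.

Lemma hom_idem e : r e = lmul q (r e) (r e) -> r e = lone q.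
Proof. by move=> ee; apply: (@lmulI _ q (r e)); rewrite lmulg1 -ee. Qed.

Lemma hom_u : r u = lone q.
Proof. by apply: hom_idem; rewrite -homM uu. Qed.

Lemma hom_rho a : r (elem (rho a)) = r a.
Proof. by rewrite elem_rho !homM hom_u lmul1g lmulg1. Qed.

(** The tau-neighbourhoods of two inseparable points generate one proper filter. If [a] is a cluster
    point of it in [S], both points are limits of products [s ∗ b] with [s] near [u] and [b] near
    [a], so [r] takes the value [r a] at both. *)
Lemma hom_inseparable (x y : L) : inseparable x y -> r (elem x) = r (elem y).
Proof.
move=> xy.
pose F := filter_from [set P : set L * set L |
  [/\ open P.1, open P.2, P.1 x & P.2 y]] (fun P => P.1 `&` P.2).
have FF : ProperFilter F.
  apply: filter_from_proper => [|[U V] [/= oU oV Ux Vy]]; last exact: xy.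
  apply: filter_from_filter; first by exists (setT, setT); split=> //;
    exact: openT.
  move=> [U V] [U' V'] [/= oU oV Ux Vy] [/= oU' oV' Ux' Vy'].
  exists (U `&` U', V `&` V'); first by split=> //=; exact: openI.
  by move=> z /= [[Uz U'z] [Vz V'z]].
have [|a [_ aF]] := cS (F := elem @ F); first exact: filterT.
have key z : (forall P : set L, open P -> P z -> F P) -> r (elem z) = r a.
  move=> Fz; rewrite -[RHS](lmul1g q) -hom_u.
  apply: rP => A B E uA aB zE; apply: contrapT => H.
  (* [P] is the complement of [u o B], with [B] restricted to [uM]. It is tau-open because
     [u o (u o B)] lies in [u o B], and it is disjoint from [B] because [u ∗ w = w] on [uM]. *)
  pose P := [set x : L | exists V W : set S, [/\ nbhs u V, nbhs (elem x) W &
    forall s (b : L), V s -> B (elem b) -> ~ W (s ∗ elem b)]].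
  have oP : open P.
    rewrite tau_openE => w [V [W [uV wW VW]]].
    exists [set s | V° (s ∗ u)], W°; split; last 1 first.
    + move=> s b Vs Wb.
      have [g Dg [Vg Wg]] := nbhs_dense (filterI (nbhs_opr Vs) (nbhs_opr Wb)).
      exists (op g @^-1` V), (op g @^-1` W); split.
      * exact: opl.
      * exact: opl.
      * by move=> s' b' Vs' Bb' Wb'; apply: (VW (g ∗ s') b') => //;
        rewrite -opA.
    + by apply: nbhs_opr; rewrite uu.
    + exact: nbhs_interior.
  have Pz : P z.
    exists A, E; split=> // s b As Bb Eb; apply: H; by exists s, (elem b).
  have FP : F (elem @^-1` (elem @` P)).
    apply: filterS (Fz P oP Pz) => w Pw; by exists w.
  have [_ [[w [V [W [uV wW VW]]] <-] Bw]] := aF _ _ FP aB.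
  apply: (VW u w (nbhs_singleton uV) Bw); rewrite (elemP w).2.
  exact: nbhs_singleton wW.
rewrite (key x) ?(key y) // => P oP Pz.
  by exists (setT, P) => [|w []//]; split=> //; exact: openT.
by exists (P, setT) => [|w []//]; split=> //; exact: openT.
Qed.

Definition hom_K (k : K) : Q := r (elem (repr k)).

Lemma hom_K_pi (x : L) : hom_K (piL x) = r (elem x).
Proof. by apply: hom_inseparable; exact: repr_piP. Qed.

Lemma hom_K_hull (x : C) : hom_K (hull_pi x) = r (hull_val x).
Proof. by rewrite hom_K_pi hom_rho. Qed.

Lemma hom_KM (k l : K) : hom_K (lmul cK k l) = lmul q (hom_K k) (hom_K l).
Proof.
rewrite -(reflect_pi_surj k) -(reflect_pi_surj l) -reflect_piM !hom_K_pi.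
by rewrite elemM homM.
Qed.

Lemma hom_K_surj a : exists k, hom_K k = r a.
Proof. by exists (piL (rho a)); rewrite hom_K_pi hom_rho. Qed.

(* An element [m] of [M] factors as [e * (u * m)] with [e] idempotent, and [r] is
   trivial at the limits of idempotents. *)
Lemma hom_closed (A : set Q) :
  closed [set k | A (hom_K k)] -> closed [set f | A (r f)].
Proof.
move=> cA f Af /=.
pose e m := m ∗ iv (u ∗ m).
have eP m : M m -> e m ∗ e m = e m /\ e m ∗ (u ∗ m) = m.
  move=> Mm; have Mum : M (u ∗ m) by exact: IM.
  have [Mi ui il ir] : [/\ M (iv (u ∗ m)), u ∗ iv (u ∗ m) = iv (u ∗ m),
      iv (u ∗ m) ∗ (u ∗ m) = u & u ∗ m ∗ iv (u ∗ m) = u].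
    by apply: ivP => //; rewrite opA uu.
  split; last by rewrite /e -opA il Mfu.
  have im : iv (u ∗ m) ∗ m = u by rewrite -{1}(Mfu Mi) -opA il.
  by rewrite /e -opA (opA _ m) im ui.
(* The filter follows the pairs [(e m, u ∗ m)] as [m] tends to [f ∗ u] with [r m] in [A]. Such [m]
   arise as [s ∗ u] with [s] tending to [f], since [r] does not change under multiplication by
   [u]. *)
pose m_ W := [set m | [/\ M m, A (r m) & W m]].
pose F := filter_from (nbhs (f ∗ u)) (fun W => [set (e m, u ∗ m) | m in m_ W]).
have FF : ProperFilter F.
  apply: filter_from_proper => [|W fW].
    apply: filter_from_filter; first by exists setT; exact: filterT.
    move=> W W' fW fW'; exists (W `&` W'); first exact: filterI.
    by move=> _ [m [Mm Am [Wm W'm]] <-]; split; exists m.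
  have [s [As Ws]] := Af _ (@opr u f _ fW).
  exists (e (s ∗ u), u ∗ (s ∗ u)); exists (s ∗ u) => //; split=> //;
    first exact: IM.
  by rewrite homM hom_u lmulg1.
have FW W : nbhs (f ∗ u) W -> F [set (e m, u ∗ m) | m in m_ W] by exists W.
have [|[p b] [_ pbF]] := compactT_setX cS cS (F := F); first exact: filterT.
have pbE (P B W : set S) : nbhs p P -> nbhs b B -> nbhs (f ∗ u) W ->
    exists m, [/\ m_ W m, P (e m) & B (u ∗ m)].
  move=> pP bB fW.
  have [|_ [[m mW <-] [/= Pm Bm]]] := pbF _ (P `*` B) (FW _ fW);
    first by exists (P, B).
  by exists m.
have rp : r p = lone q.
  apply: hom_idem; apply: rP => P B E pP pB pE.
  have [m [[Mm _ _] [[Pm Bm] Em] _]] :=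
    pbE _ setT setT (filterI (filterI pP pB) pE) filterT filterT.
  by exists (e m), (e m); split=> //; rewrite (eP m Mm).1.
have rf : r f = r b.
  rewrite -[LHS](lmulg1 q) -hom_u -homM -[RHS](lmul1g q) -rp.
  apply: rP => P B E pP bB fE.
  have [m [[Mm _ Em] Pm Bm]] := pbE _ _ _ pP bB fE.
  by exists (e m), (u ∗ m); split=> //; rewrite (eP m Mm).2.
rewrite rf; apply: contrapT => nAb.
have Mb : M b.
  apply: cM => B bB; have [m [[Mm _ _] _ Bm]] := pbE setT _ setT filterT bB
    filterT.
  by exists (u ∗ m); split=> //; exact: IM.
(* If [r b] were outside [A], the elements [u ∗ m] of [uM] close to [b] would be outside too,
   whereas [r (u ∗ m) = r m] is in [A]. *)
have oU : open (piL @^-1` ~` [set k | A (hom_K k)]).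
  apply: (open_comp_cont (@reflect_pi_cont _ _ tau_contL tau_contR)).
  exact: closed_openC.
have Ub : (piL @^-1` ~` [set k | A (hom_K k)]) (rho b).
  by rewrite /= hom_K_pi hom_rho.
have [m [[Mm Am _] _ Bm]] :=
  pbE setT _ setT filterT (tau_open_nbhs Mb oU Ub) filterT.
have := Bm (rho m); rewrite elem_rhoM //= => /(_ erefl).
by rewrite hom_K_pi hom_rho.
Qed.
End Hom.

End EllisGroup.

(** [C] is the closure of [uM], with its maps [j] and [p]. Closed sets go from [S] to [K] by pulling
    back along [j] and pushing forward along [p]; the last clause is the converse. Together they
    show that [S] and [K] induce the same quotient topology on the image of [r]. *)
Theorem ellis_group_quotient (S : topologicalType) (op : S -> S ->
  S) (D : set S) :
  compact [set: S] -> hausdorff_space S -> [set: S] !=set0 ->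
  associative op -> (forall h, continuous (op^~ h)) ->
  (forall g, D g -> continuous (op g)) -> dense D ->
  exists (K : topologicalType) (c : group_law K) (C : topologicalType)
    (j : C -> S) (p : C -> K),
  [/\ topological_group c, compact [set: K], hausdorff_space K &
    [/\ compact [set: C], continuous j, continuous p & forall k, exists x,
      p x = k]] /\
  forall (Q : Type) (q : group_law Q) (r : S -> Q),
    (forall a b d : S,
      (forall A B E : set S, nbhs a A -> nbhs b B -> nbhs d E ->
        exists x y, [/\ A x, B y & E (op x y)]) ->
      r d = lmul q (r a) (r b)) ->
    exists rK : K -> Q,
    [/\ forall k l, rK (lmul c k l) = lmul q (rK k) (rK l),
      forall x, rK (p x) = r (j x), forall a, exists k, rK k = r a
      & forall A : set Q, closed [set k | A (rK k)] ->
        closed [set a | A (r a)]].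
Proof.
move=> cS hS S0 opA opr opl dD.
have [M [u [iv [cM Mu IM Mfu ivP]]]] := ellis_minimal_ideal cS hS opA opr S0.
exists _, (reflect_law
  (@tau_contL _ _ _ opA opr opl dD _ _ _ Mu IM Mfu ivP)
  (@tau_contR _ _ opA opr _ _ _ Mu IM Mfu ivP)), _, (@hull_val S op M u),
  (@hull_pi _ _ _ opA opr opl dD _ _ _ Mu IM Mfu ivP).
split.
  split; [exact: ellis_topological_group|exact: ellis_compact
    |exact: ellis_hausdorff|].
  split; [exact: hull_compact|exact: hull_val_cont|exact: hull_pi_cont|].
  move=> k; exists (to_hull (repr k)).
  by rewrite hull_pi_to_hull reflect_pi_surj.
move=> Q q r rP; exists (hom_K r); split.
- exact: (hom_KM cS rP).
- by move=> x; apply: (hom_K_hull cS _ _ _ _ _ _ _ _ rP).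
- exact: (hom_K_surj cS _ _ _ _ _ _ _ _ rP).
- by move=> A; apply: (hom_closed cS cM rP).
Qed.

(** * Analytic sets and closed subgroups *)

Lemma analytic_preimage (S T : topologicalType) (f : S -> T) (A : set T) :
  continuous f -> analytic A -> analytic [set x | A (f x)].
Proof.
move=> cf [P cP ->]; exists (fun s => [set x | P s (f x)]) => //.
by move=> s; exact: closed_comp_cont.
Qed.

(* The Souslin scheme has to be made decreasing before taking images, for the
   image to commute with the intersections along the branches. *)
Lemma analytic_image (S T : topologicalType) (f : S -> T) (A : set S) :
  compact [set: S] -> hausdorff_space T -> continuous f ->
  analytic A -> analytic (f @` A).
Proof.
move=> cS hT cf [P cP ->].
pose Q s := \bigcap_(k in [set k | (k <= size s)%N]) P (take k s).
have cQ s : closed (Q s) by apply: closed_bigI => k _.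
have QE a n : Q (mkseq a n) = \bigcap_(k in [set k | (k <= n)%N]) P (mkseq a k).
  rewrite /Q size_mkseq; apply: eq_bigcapr => k /= kn.
  by rewrite /mkseq -map_take take_iota (minn_idPl kn).
exists (fun s => f @` Q s); first by move=> s; exact: closed_map_compact.
apply/seteqP; split=> [_ [x [a _ xa] <-]|y [a _ ya]].
  by exists a => // n _; exists x => //; rewrite QE => k _; exact: xa.
have [|||x xQ] := @compact_nested S (fun n => Q (mkseq a n) `&` [set x | [set
  y] (f x)]) cS.
- move=> n; apply: closedI => //; apply: closed_comp_cont cf _.
  exact/accessible_closed_set1/hausdorff_accessible.
- by move=> n; have [x Qx fx] := ya n I; exists x.
- move=> n x [+ fx]; rewrite !QE => Qx; split=> // k /= kn.
  by apply: Qx; exact: leqW.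
exists x; last by have [_] := xQ 0%N I.
exists a => // n _; have [+ _] := xQ n I; rewrite QE; apply; exact: leqnn.
Qed.

Lemma closure_subset_comp (S T : topologicalType) (f : S ->
  T) (A : set S) (B : set T) :
  continuous f -> closed B -> (forall x, A x -> B (f x)) ->
  forall x, closure A x -> B (f x).
Proof.
move=> cf cB AB x Ax; have := closed_comp_cont cf cB; apply.
exact: (closureS AB).
Qed.

Lemma set_type_cont (S T : topologicalType) (A : set T) (f : S -> set_type A) :
  continuous (fun x => set_val (f x)) -> continuous f.
Proof.
move=> cf; apply/continuousP => _ [W oW <-].
exact: (open_comp_cont cf).
Qed.

Lemma ptws_cont (S X Y : topologicalType) (f : S -> {ptws X -> Y}) :
  (forall x, continuous (fun s => f s x)) -> continuous f.
Proof.
move=> cf s; apply/cvg_sup => x A /= [_ [[B oB <-] Bfs BA]].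
have sB : nbhs s [set t | B (f t x)] by apply: cf; exact: open_nbhs_nbhs.
by apply: (@filterS _ (nbhs s) _ _ _ _ sB) => t Bt; exact: BA.
Qed.

Lemma eval_cont (X Y : topologicalType) (x : X) :
  continuous (fun f : {ptws X -> Y} => f x).
Proof. exact: (@proj_continuous _ (fun _ : X => Y) x). Qed.

Section ClosureSubgroup.
Variables (T : topologicalType) (c : group_law T) (H : set T).
Hypotheses (tc : topological_group c) (HP : is_subgroup c H).

Lemma closure_subgroup : is_subgroup c (closure H).
Proof.
have [H1 HM HV] := HP; have cH := @closed_closure _ H.
split; first exact: subset_closure.
  have HcH h y : H h -> closure H y -> closure H (lmul c h y).
    move=> Hh; apply: (@closure_subset_comp _ _ (fun y => lmul c h y)) => //.
      by apply: lmul_continuous => //; [exact: cst_cont|exact: id_cont].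
    by move=> x Hx; apply: subset_closure; exact: HM.
  move=> x y Hx Hy; move: x Hx.
  apply: (@closure_subset_comp _ _ (fun x => lmul c x y)) => //.
    by apply: lmul_continuous => //; [exact: id_cont|exact: cst_cont].
  by move=> h Hh; exact: HcH.
apply: (@closure_subset_comp _ _ (linv c)) => //; first exact: tc.2.
by move=> h Hh; apply: subset_closure; exact: HV.
Qed.
End ClosureSubgroup.

Section SubgroupType.
Variables (T : topologicalType) (c : group_law T) (A : set T).
Hypotheses (tc : topological_group c) (AP : is_subgroup c A).
Local Notation G := (set_type A).

Let AM (x y : G) : A (lmul c (set_val x) (set_val y)).
Proof. by have [_ h _] := AP; apply: h; exact: set_valP. Qed.
Let AV (x : G) : A (linv c (set_val x)).
Proof. by have [_ _ h] := AP; apply: h; exact: set_valP. Qed.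
Let A1 : A (lone c). Proof. by have [] := AP. Qed.

Let mul (x y : G) : G := SigSub (mem_set (AM x y)).
Let inv (x : G) : G := SigSub (mem_set (AV x)).
Let one : G := SigSub (mem_set A1).

Let mulA : associative mul.
Proof. by move=> x y z; apply: val_inj; exact: lmulA. Qed.
Let mul1 : left_id one mul.
Proof. by move=> x; apply: val_inj; exact: lmul1g. Qed.
Let mulr1 : right_id one mul.
Proof. by move=> x; apply: val_inj; exact: lmulg1. Qed.
Let mulV : left_inverse one inv mul.
Proof. by move=> x; apply: val_inj; exact: lmulVg. Qed.
Let mulrV : right_inverse one inv mul.
Proof. by move=> x; apply: val_inj; exact: lmulgV. Qed.

Definition subgroup_law : group_law G := mk_group_law mulA mul1 mulr1 mulV
  mulrV.

Lemma subgroup_topological : topological_group subgroup_law.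
Proof.
split; apply: set_type_cont.
  apply: (lmul_continuous tc); apply: comp_cont (@set_val_cont _ A) => x.
    exact: cvg_fst.
  exact: cvg_snd.
by apply: (linv_continuous tc); exact: set_val_cont.
Qed.

End SubgroupType.

(** The dichotomy is applied inside the compact group [closure H], where an open subgroup is also
    closed: a point [k] of the closure has some [l] in [H] so near that the quotient of [k] by [l]
    falls into [H]. *)
Lemma analytic_subgroup_closure (T : topologicalType) (c : group_law T) (H :
  set T) :
  topological_group c -> compact [set: T] -> hausdorff_space T ->
  is_subgroup c H -> analytic H -> closed H \/
  exists f : (nat -> bool) -> T, (forall a, closure H (f a)) /\
    forall a b, a <> b -> ~ H (lmul c (linv c (f a)) (f b)).
Proof.
move=> tc cT hT HP aH.
have cHP := closure_subgroup tc HP.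
have [H1 HM HV] := HP.
pose H' := [set x : set_type (closure H) | H (set_val x)].
have H'P : is_subgroup (subgroup_law cHP) H'.
  by split; [exact: H1|move=> x y; exact: HM|move=> x; exact: HV].
have [|||[W oW WE]|[f fP]] :=
    analytic_subgroup_dichotomy (subgroup_topological tc cHP) _ _ H'P.
- apply: compact_set_type; apply: subclosed_compact cT _ => //.
  exact: closed_closure.
- exact: hausdorff_set_type.
- exact: analytic_preimage (@set_val_cont _ _) aH.
- left=> k Hk.
  have : nbhs k [set l | W (lmul c (linv c l) k)].
    apply: open_nbhs_nbhs; split.
      apply: open_comp_cont oW; apply: (lmul_continuous tc);
        last exact: cst_cont.
      exact: tc.2.
    rewrite /= lmulVg; have [cH1 _ _] := cHP.
    have : H' (SigSub (mem_set cH1)) by exact: H1.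
    by rewrite -WE.
  move=> /Hk[l [Hl Wl]].
  have clk : closure H (lmul c (linv c l) k).
    have [_ cHM _] := cHP; apply: cHM => //; apply: subset_closure; exact: HV.
  have : H' (SigSub (mem_set clk)) by rewrite -WE.
  by move=> /(HM _ _ Hl); rewrite /= lmulVKg.
- right; exists (fun a => set_val (f a)); split; first by move=> a;
    exact: set_valP.
  by move=> a b /fP.
Qed.

(** * Quotients of compact groups *)

Lemma quot_closedP (X : topologicalType) (E : equiv_rel X) (A : set (quot E)) :
  closed A <-> closed [set x | A (cls E x)].
Proof.
have e : ~` [set x | A (cls E x)] = cls E @^-1` (~` A) by [].
split=> [cA|cA]; first exact: (closed_comp_cont (@pi_continuous _ _) cA).
by rewrite -openC; move: cA; rewrite -openC e.
Qed.

Lemma quotient_map_homeo (K Y : topologicalType) (R : equiv_rel K) (f : K ->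
  Y) :
  (forall y, exists k, f k = y) ->
  (forall A : set Y, closed A <-> closed [set k | A (f k)]) ->
  (forall k l, f k = f l <-> R k l) -> homeomorphic Y (quot R).
Proof.
move=> /choice[s fs] fA fR.
have fr (k : K) : f (repr (cls R k)) = f k by apply/fR/clsP; exact: cls_repr.
have sf (k : K) : cls R (s (f k)) = cls R k by apply/clsP/fR.
exists (fun y => cls R (s y)), (fun q => f (repr q)); split.
- apply/continuous_closedP => A /quot_closedP cA; apply/fA.
  by congr (closed _): cA; apply/seteqP; split=> k /=; rewrite sf.
- apply/continuous_closedP => A /fA cA; apply/quot_closedP.
  by congr (closed _): cA; apply/seteqP; split=> k /=; rewrite fr.
- by move=> y; rewrite fr fs.
- by move=> q; rewrite sf cls_repr.
Qed.

Lemma closed_graph_hausdorff (X : topologicalType) (E : equiv_rel X) :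
  hausdorff_space (quot E) -> closed (graph_of E).
Proof.
move=> hE; rewrite -openC openE => -[x y] /= nE.
have : cls E x != cls E y by apply/eqP => /clsP.
move: (hE); rewrite open_hausdorff => /[apply] -[[U V] /= [Ux Vy] [oU oV UV]].
rewrite !inE in Ux Vy.
have cE := @pi_continuous _ {eq_quot E}.
exists ([set x | U (cls E x)], [set y | V (cls E y)]).
  by split; apply: open_nbhs_nbhs; split=> //; exact: (open_comp_cont cE).
move=> [a b] [/= Ua Vb] /clsP ab; have : (U `&` V) (cls E a) by split=> //;
  rewrite ab.
by rewrite (eqP UV).
Qed.

Section TransitiveQuotient.
Variables (X : topologicalType) (E : equiv_rel X) (K : topologicalType).
Variables (c : group_law K) (H : set K) (f : K -> quot E).
Hypotheses (tc : topological_group c) (cK : compact [set: K]) (hK :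
  hausdorff_space K).
Hypotheses (HP : is_subgroup c H) (aH : analytic H).
Hypotheses (fs : forall y, exists k, f k = y).
Hypothesis fA : forall A : set (quot E), closed A <-> closed [set k | A (f k)].
Hypothesis fH : forall k l, f k = f l <-> H (lmul c (linv c k) l).
Local Notation "x ∗ y" := (lmul c x y) (at level 40, left associativity).
Local Notation "x ^v" := (linv c x) (at level 3, format "x ^v").

Let mul_contl k : continuous (lmul c k).
Proof. by apply: (lmul_continuous tc); [exact: cst_cont|exact: id_cont]. Qed.
Let mul_contr k : continuous (lmul c ^~ k).
Proof. by apply: (lmul_continuous tc); [exact: id_cont|exact: cst_cont]. Qed.

Let f_openP (A : set (quot E)) : open [set k | A (f k)] -> open A.
Proof.
move=> oA; rewrite -closedC; apply/fA.
by have := open_closedC oA.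
Qed.

Lemma coset_open_map U : open U -> open (f @` U).
Proof.
move=> oU; apply: f_openP.
have -> : [set k | (f @` U) (f k)] = \bigcup_(h in H) [set k | U (k ∗ h)].
  apply/seteqP; split=> [k [l Ul /esym/fH Hkl]|k [h Hh Uk]].
    by exists (k^v ∗ l) => //=; rewrite lmulVKg.
  by exists (k ∗ h) => //; apply/esym/fH; rewrite lmulKg.
by apply: bigcup_open => h _; exact: (open_comp_cont (@mul_contr h)).
Qed.

Lemma quotient_hausdorff : closed H -> hausdorff_space (quot E).
Proof.
move=> cH; apply: (hausdorff_open_map fs coset_open_map) => k l kl.
have cd : continuous (fun p : K * K => p.1^v ∗ p.2).
  apply: (lmul_continuous tc) => [|x]; last exact: cvg_snd.
  by apply: (linv_continuous tc) => x; exact: cvg_fst.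
have nH : (~` H) (k^v ∗ l) by move=> /fH.
have oH := open_comp_cont cd (closed_openC cH).
have kl_H : nbhs (k, l) [set p : K * K | (~` H) (p.1^v ∗ p.2)].
  exact: open_nbhs_nbhs.
have [U [V [oU oV Uk Vl UV]]] := prod_nbhsP kl_H.
exists U, V; split=> // a b Ua Vb /fH; exact: (UV (a, b)).
Qed.

(** An open [H] makes the quotient discrete. *)
Lemma graph_clopen : open H -> clopen (graph_of E).
Proof.
move=> oH.
have oA (A : set (quot E)) : open A.
  apply: f_openP.
  have -> : [set k | A (f k)] = \bigcup_(l in [set l | A (f l)]) [set k | H
    (l^v ∗ k)].
    apply/seteqP; split=> [k Ak|k [l Al /fH lk]].
      by exists k => //=; rewrite lmulVg; have [] := HP.
    by rewrite /= -lk.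
  by apply: bigcup_open => l _; exact: (open_comp_cont (@mul_contl _)).
have cE := @pi_continuous _ {eq_quot E}.
split; last first.
  apply: closed_graph_hausdorff => p q pq.
  by have [_ [-> ->]] := pq [set p] [set q] (open_nbhs_nbhs (conj (oA _) erefl))
    (open_nbhs_nbhs (conj (oA _) erefl)).
rewrite openE => -[x y] /= xy.
exists ([set a | [set cls E x] (cls E a)], [set b | [set cls E x] (cls E b)]).
  split; apply: open_nbhs_nbhs; split.
  - exact: (open_comp_cont cE (oA [set cls E x])).
  - by [].
  - exact: (open_comp_cont cE (oA [set cls E x])).
  - by apply/esym/clsP.
by move=> [a b] [/= ax bx]; apply/clsP; rewrite ax bx.
Qed.

Lemma clopen_or_continuum :
  clopen (graph_of E) \/ at_least_continuum [set: quot E].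
Proof.
have [oH|[g gP]] := analytic_subgroup_dichotomy tc cK hK HP aH.
  by left; exact: graph_clopen.
right; have : $|{injfun [set: nat -> bool] >-> [set: quot E]}|.
  apply/injfunPex; exists (fun a => f (g a)) => // a b _ _ /fH ab.
  by apply: contrapT => /gP.
by move=> [h]; exact: inj_card_le h.
Qed.

(** The preimage in [K] of the classes of [Y] is closed and contains a coset of [H], hence the whole
    coset [k ∗ closure H]; if [H] is not closed, this splits into at least continuum many cosets of
    [H]. *)
Lemma nonclosed_restricted_continuum (Y : set X) : ~ closed (graph_of E) ->
  Y !=set0 -> closed Y -> saturated E Y ->
  at_least_continuum (restricted_classes E Y).
Proof.
move=> ncE [y Yy] cY [B YE].
have [cH|[g [gH gP]]] := analytic_subgroup_closure tc cK hK HP aH.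
  by case: ncE; apply: closed_graph_hausdorff; exact: quotient_hausdorff.
pose A : set (quot E) := [set e | exists2 x, Y x & cls E x = e].
have cA : closed A.
  apply/quot_closedP; congr (closed _): cY; apply/seteqP; split=> x.
    by exists x.
  move=> [z + /clsP zx]; rewrite YE => -[b Bb bz]; exists b => //.
  exact: equiv_trans bz zx.
have [k fk] := fs (cls E y).
have kA m : closure H m -> A (f (k ∗ m)).
  apply: (@closure_subset_comp _ _ (lmul c k) _ [set l | A (f l)]) => //.
    exact/fA.
  move=> h Hh; exists y => //; rewrite -fk; apply/fH.
  by rewrite lmulKg.
have /choice[w wP] : forall a, exists x, Y x /\ cls E x = f (k ∗ g a).
  by move=> a; have [x Yx xe] := kA _ (gH a); exists x.
have : $|{injfun [set: nat -> bool] >-> restricted_classes E Y}|.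
  apply/injfunPex; exists (fun a => Y `&` [set z | E (w a) z]).
    by move=> a _; exists (w a) => //; exact: (wP a).1.
  move=> a b _ _ ab; apply: contrapT => /gP; apply.
  have [[Ya ea] [Yb eb]] := (wP a, wP b).
  have : (Y `&` [set z | E (w b) z]) (w b) by split=> //=; exact: equiv_refl.
  rewrite -ab => -[_ /= /clsP]; rewrite ea eb => /fH.
  by rewrite linvM -lmulA lmulKg.
by move=> [h]; exact: inj_card_le h.
Qed.

Lemma transitive_quotient : quotient_of_compact_group (quot E).
Proof.
have [S SP] := subgroup_groupClosed HP.
exists K, c, S; split=> //.
  suff -> : [set x | x \in S] = H by [].
  by apply/seteqP; split=> x /=; rewrite SP => /asboolP.
apply: (quotient_map_homeo fs fA) => k l.
have -> : (lcoset_equiv S k l) = (lmul c (linv c k) l \in S) by [].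
by rewrite SP; split=> [/fH/asboolP|/asboolP/fH].
Qed.

End TransitiveQuotient.

(** * The enveloping semigroup of an ambit *)

(** Pseudocompleteness without nets: the net is indexed by triples of neighbourhoods of the three
    points, ordered by reverse inclusion. *)
Lemma pseudocomplete_closure (G : groupType) (Z : ambit G) (Gt : groupType)
    (eqv : equiv_rel Gt) (i : {eq_quot eqv} -> Z) (x1 x2 x3 : Z) :
  pseudocomplete i ->
  (forall A B E : set Z, nbhs x1 A -> nbhs x2 B -> nbhs x3 E ->
    exists g z, [/\ A (act g base), B z & E (act g z)]) ->
  let pt g := i (\pi_{eq_quot eqv} g) in
  exists g1 g2 : Gt, [/\ pt g1 = x1, pt g2 = x2 & pt (g1 * g2)%g = x3].
Proof.
move=> pc H.
pose I := {W : set Z * set Z * set Z | [/\ nbhs x1 W.1.1,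
  nbhs x2 W.1.2 & nbhs x3 W.2]}.
have /choice[gz gzP] : forall W : I, exists q : G * Z,
    [/\ (sval W).1.1 (act q.1 base), (sval W).1.2 q.2 & (sval W).2 (act q.1
      q.2)].
  by case=> [[[A B] E] [/= xA xB xE]]; have [g [z gzW]] := H _ _ _ xA xB xE;
    exists (g, z).
pose le (V W : I) := [/\ (sval W).1.1 `<=` (sval V).1.1,
  (sval W).1.2 `<=` (sval V).1.2 & (sval W).2 `<=` (sval V).2].
have mkI A B E : nbhs x1 A -> nbhs x2 B -> nbhs x3 E ->
    exists W : I, sval W = (A, B, E).
  move=> xA xB xE.
  by exists (exist (fun W : set Z * set Z * set Z =>
    [/\ nbhs x1 W.1.1, nbhs x2 W.1.2 & nbhs x3 W.2]) (A, B, E) (And3 xA xB xE)).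
apply: (pc I le (fun W => (gz W).1) (fun W => (gz W).2)).
- split.
  + by have [W _] := mkI _ _ _ filterT filterT filterT; exists.
  + by move=> W; split.
  + move=> U V W [UV1 UV2 UV3] [VW1 VW2 VW3]; split.
    * exact: subset_trans VW1 UV1.
    * exact: subset_trans VW2 UV2.
    * exact: subset_trans VW3 UV3.
  + move=> [[[A B] E] [/= xA xB xE]] [[[A' B'] E'] [/= xA' xB' xE']].
    have [W WE] := mkI _ _ _ (filterI xA xA') (filterI xB xB') (filterI xE xE').
    by exists W; split; rewrite WE /=; try exact: subIsetl; exact: subIsetr.
- move=> A xA; have [W WE] := mkI A _ _ xA filterT filterT.
  by exists W => // V [+ _ _]; rewrite WE /=; apply; have [] := gzP V.
- move=> A xA; have [W WE] := mkI _ A _ filterT xA filterT.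
  by exists W => // V [_ + _]; rewrite WE /=; apply; have [] := gzP V.
- move=> A xA; have [W WE] := mkI _ _ A filterT filterT xA.
  by exists W => // V [_ _ +]; rewrite WE /=; apply; have [] := gzP V.
Qed.

Section EnvelopingSemigroup.
Variables (G : groupType) (Z : ambit G).

Definition translations : set {ptws Z -> Z} := range (fun g : G => act g).
Definition enveloping : topologicalType := set_type (closure translations).
Local Notation S := enveloping.
Definition ev (s : S) (z : Z) : Z := (set_val s : {ptws Z -> Z}) z.

Lemma ev_cont z : continuous (ev^~ z).
Proof. exact: (comp_cont (@set_val_cont _ (closure translations)) (@eval_cont Z
  Z z)). Qed.

Lemma enveloping_cont (T : topologicalType) (f : T -> S) :
  (forall z, continuous (fun x => ev (f x) z)) -> continuous f.
Proof. by move=> cf; apply: set_type_cont; exact: ptws_cont. Qed.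

Lemma ev_inj s t : ev s =1 ev t -> s = t.
Proof. by move=> st; apply: val_inj; exact/funext. Qed.

Lemma enveloping_compact : compact [set: S].
Proof.
apply: compact_set_type.
have -> : closure translations =
    [set f | forall z : Z, [set: Z] (f z)] `&` closure translations.
  by apply/seteqP; split=> [f|f []].
apply: compact_closedI; last exact: closed_closure.
exact: (@tychonoff Z (fun=> space Z) (fun=> setT) (fun=> @space_compact _ Z)).
Qed.

Lemma enveloping_hausdorff : hausdorff_space S.
Proof.
apply: hausdorff_set_type.
exact: (@hausdorff_product Z (fun=> space Z) (fun=> @space_hausdorff _ Z)).
Qed.

Lemma enveloping_near (s : S) (A : set {ptws Z -> Z}) :
  nbhs (set_val s) A -> exists g : G, A (act g).
Proof. by move=> /(set_valP s)[_ [[g _ <-] Ag]]; exists g. Qed.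

(** Closure under composition takes two steps: composition is continuous in its right factor when
    the left one is a translation, and in its left factor always. *)
Lemma translation_comp (g : G) (f : {ptws Z -> Z}) :
  closure translations f -> closure translations (fun z => act g (f z)).
Proof.
apply: (@closure_subset_comp _ _ (fun f : {ptws Z -> Z} =>
  (fun z => act g (f z)) : {ptws Z -> Z})).
- apply: ptws_cont => z; apply: comp_cont (@act_continuous _ Z g).
  exact: eval_cont.
- exact: closed_closure.
- move=> _ [h _ <-]; apply: subset_closure; exists (g * h)%g => //.
  by apply/funext => z; rewrite act_mul.
Qed.

Lemma closure_comp (f h : {ptws Z -> Z}) : closure translations f ->
  closure translations h -> closure translations (fun z => f (h z)).
Proof.
move=> + ch; move: f; apply: (@closure_subset_comp _ _ (fun f : {ptws Z -> Z} =>
  (fun z => f (h z)) : {ptws Z -> Z})).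
- by apply: ptws_cont => z; exact: eval_cont.
- exact: closed_closure.
- by move=> _ [g _ <-]; exact: translation_comp.
Qed.

Definition env_comp (s t : S) : S :=
  SigSub (mem_set (closure_comp (set_valP s) (set_valP t))).

Definition env_translation (g : G) : S :=
  SigSub (mem_set (subset_closure (imageT (fun g : G => act g : {ptws Z ->
    Z}) g))).

Lemma env_translation_dense : dense (range env_translation).
Proof.
move=> O [s Os] [W oW WO]; rewrite -WO in Os *.
have [g Wg] := enveloping_near (open_nbhs_nbhs (conj oW Os)).
by exists (env_translation g); split=> //; exists g.
Qed.

End EnvelopingSemigroup.

Lemma properly_group_like_limit (G : groupType) (Z : ambit G) (F : equiv_rel Z)
    (c : group_law (quot F)) (Gt : groupType) (eqv : equiv_rel Gt)
    (i : {eq_quot eqv} -> Z) (x1 x2 x3 : Z) :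
  properly_group_like_via i c ->
  (forall A B E : set Z, nbhs x1 A -> nbhs x2 B -> nbhs x3 E ->
    exists g z, [/\ A (act g base), B z & E (act g z)]) ->
  cls F x3 = lmul c (cls F x1) (cls F x2).
Proof.
move=> [_ _ hom pc _] H.
have [g1 [g2 [<- <- <-]]] := pseudocomplete_closure pc H.
exact: hom.
Qed.

Lemma cls_base (G : groupType) (Z : ambit G) (F : equiv_rel Z)
    (c : group_law (quot F)) : group_like_law c -> cls F base = lone c.
Proof.
move=> [_ h _]; apply: (@lmulI _ c (cls F base)); rewrite lmulg1.
by rewrite -[X in lmul c (cls F X) _](act_one base) h act_one.
Qed.

(** * Transfer from the dominating ambit to [X/E] *)

Section Domination.
Variables (G : groupType) (Z X : ambit G) (F : equiv_rel Z) (c : group_law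
  (quot F)).
Variables (Gt : groupType) (eqv : equiv_rel Gt) (i : {eq_quot eqv} -> Z).
Hypothesis pgl : properly_group_like_via i c.
Variables (E : equiv_rel X) (phi : Z -> X).
Hypotheses (phiM : ambit_morphism phi) (FE : forall z z', F z z' ->
  E (phi z) (phi z')).
Local Notation S := (enveloping Z).

Definition base_class (s : S) : quot F := cls F (ev s base).

(** Pseudocompleteness speaks of translations, so the left factor [x] is replaced by some [g] in [G]
    that is close to it at the two points [base] and [ev y base]. *)
Lemma base_class_limit (a b d : S) :
  (forall A B C : set S, nbhs a A -> nbhs b B -> nbhs d C ->
    exists x y, [/\ A x, B y & C (env_comp x y)]) ->
  base_class d = lmul c (base_class a) (base_class b).
Proof.
move=> H; apply: (properly_group_like_limit pgl) => A B C aA bB dC.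
have evn (s : S) (W : set Z) : nbhs (ev s base) W ->
    nbhs s [set t : S | W° (ev t base)].
  by move=> /nbhs_interior; exact: (@ev_cont _ Z base s).
have [x [y [Ax By Cxy]]] := H _ _ _ (evn _ _ aA) (evn _ _ bB) (evn _ _ dC).
have [g [Ag Cg]] : exists g : G, A (act g base) /\ C (act g (ev y base)).
  have := @enveloping_near _ Z x
    ([set f | A (f base)] `&` [set f | C (f (ev y base))]).
  apply; apply: filterI.
    exact: (@eval_cont Z Z base (set_val x) _ Ax).
  exact: (@eval_cont Z Z (ev y base) (set_val x) _ Cxy).
exists g, (ev y base); split=> //; exact: interior_subset By.
Qed.

(** The image of the compact [S] is closed and contains the dense orbit. *)
Lemma ev_base_surj z : exists s : S, ev s base = z.
Proof.
have cl : closed ((fun s : S => ev s base) @` setT).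
  apply: closed_map_compact; [exact: enveloping_compact
    |exact: space_hausdorff| |].
    exact: ev_cont.
  exact: closedT.
suff : ((fun s : S => ev s base) @` setT) z by move=> [s _ sz]; exists s.
apply: cl => W; rewrite nbhsE => -[U [oU Uz] UW].
have [|y [Uy [g _ gy]]] := @base_dense _ Z U _ oU; first by exists z.
exists y; split; last exact: UW.
by exists (env_translation Z g).
Qed.

Definition induced (q : quot F) : quot E := cls E (phi (repr q)).

Lemma induced_cls z : induced (cls F z) = cls E (phi z).
Proof. by apply/clsP/FE/clsP; exact: cls_repr. Qed.

Variable a : quot F -> quot E -> quot E.
Hypothesis aP : forall p q, induced (lmul c p q) = a p (induced q).
Hypothesis aE : analytic (graph_of E).

Lemma dominated_conclusion :
  [/\ quotient_of_compact_group (quot E),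
      clopen (graph_of E) \/ at_least_continuum [set: quot E]
    & ~ closed (graph_of E) ->
      forall Y : set X, Y !=set0 -> closed Y -> saturated E Y ->
        at_least_continuum (restricted_classes E Y)].
Proof.
have [phic _ phis phi0] := phiM.
have [] := @ellis_group_quotient S (@env_comp _ Z) (range (@env_translation _
  Z)).
- exact: enveloping_compact.
- exact: enveloping_hausdorff.
- by exists (env_translation Z 1%g).
- by move=> s t w; apply: ev_inj.
- by move=> h; apply: enveloping_cont => z; exact: ev_cont.
- move=> _ [g _ <-]; apply: enveloping_cont => z.
  by apply: comp_cont (@act_continuous _ Z g); exact: ev_cont.
- exact: env_translation_dense.
move=> K [cK [C [j [p [[tK compK hK [compC jc pc ps]]]]]]].
move=> /(_ _ c base_class base_class_limit)[rK [rKM rKp rKs rKcl]].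
pose o := cls E (base : X).
have io : induced (lone c) = o.
  by rewrite -(cls_base (let: And5 h _ _ _ _ := pgl in h)) induced_cls phi0.
(* Every value of [induced] is the translate of [o] by its argument, so the action is transitive and
   [H] is the stabilizer of [o]. *)
have ia q : induced q = a q o by rewrite -io -aP lmulg1.
have rK1 : rK (lone cK) = lone c.
  by apply: (@lmulI _ c (rK (lone cK))); rewrite -rKM !lmulg1.
have rKV k : rK (linv cK k) = linv c (rK k).
  by apply: (@lmulI _ c (rK k)); rewrite -rKM !lmulgV.
pose f k := induced (rK k).
pose H := [set k | f k = o].
have fH k l : f k = f l <-> H (lmul cK (linv cK k) l).
  rewrite /H /= /f rKM rKV; split=> [kl|Hkl].
    by rewrite aP -kl -aP lmulVg.
  by rewrite -[in RHS](lmulVKg c (rK k) (rK l)) aP Hkl -ia.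
have fp x : f (p x) = cls E (phi (ev (j x) base)).
  by rewrite /f rKp induced_cls.
have fs y : exists k, f k = y.
  have [z zy] := phis (repr y); have [s sz] := ev_base_surj z.
  have [k rk] := rKs s; exists k.
  by rewrite /f rk /base_class sz induced_cls zy cls_repr.
have ec : continuous (fun s : S => phi (ev s base)).
  exact: comp_cont (@ev_cont _ Z base) phic.
(* [K] and [X] induce the same topology on the quotient: one direction passes through [C], the other
   through the last clause on [rK] and the compactness of [S]. *)
have fA (A : set (quot E)) : closed A <-> closed [set k | A (f k)].
  split=> [/quot_closedP cA|cA].
    have -> : [set k | A (f k)] =
        p @` [set x | [set x | A (cls E x)] (phi (ev (j x) base))].
      apply/seteqP; split=> [k Ak|_ [x Ax <-]] /=; last by rewrite fp.
      by have [x xk] := ps k; exists x => //=; rewrite -fp xk.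
    apply: closed_map_compact => //; apply: closed_comp_cont cA.
    exact: comp_cont jc ec.
  have {}cA := rKcl [set q | A (induced q)] cA.
  apply/quot_closedP.
  have -> : [set x | A (cls E x)] =
      (fun s : S => phi (ev s base)) @` [set s | A (induced (base_class s))].
    apply/seteqP; split=> [x Ax|_ [s As <-]] /=; last first.
      by rewrite -induced_cls.
    have [z zx] := phis x; have [s sz] := ev_base_surj z.
    exists s; last by rewrite sz.
    by rewrite /= /base_class sz induced_cls zx.
  apply: closed_map_compact => //; first exact: enveloping_compact.
  exact: space_hausdorff.
have HP : is_subgroup cK H.
  split.
  - by rewrite /H /= /f rK1.
  - by move=> k l Hk Hl; rewrite /H /= /f rKM aP -/(f l) Hl -ia.
  - move=> k Hk; have fk : induced (rK k) = o := Hk.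
    by rewrite /H /= /f rKV ia -[X in a _ X]fk -aP lmulVg.
have aH : analytic H.
  (* [H] is the image under [p] of a preimage in [C] of the [E]-class of [base], and both operations
     preserve analyticity. *)
  have -> : H = p @` [set x | graph_of E (base, phi (ev (j x) base))].
    apply/seteqP; split=> [k Hk|_ [x /clsP xE <-]].
      have [x xk] := ps k; exists x => //=; apply/clsP.
      by rewrite -fp xk Hk.
    by rewrite /H /= fp -xE.
  apply: analytic_image => //.
  apply: (analytic_preimage (f := fun x => (base, phi (ev (j x) base))) _ aE).
  by apply: pair_cont; [exact: cst_cont|exact: comp_cont jc ec].
split.
- exact: (transitive_quotient tK compK hK HP aH fs fA fH).
- exact: (clopen_or_continuum tK compK hK HP aH fA fH).
- by move=> ncE Y; exact: (nonclosed_restricted_continuum tK compK hK HP aH fs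
    fA fH).
Qed.

End Domination.

Theorem theorem1 (G : groupType) (X : ambit G) (E : equiv_rel X) :
  weakly_uniformly_properly_group_like E ->
  analytic (graph_of E) ->
  [/\ quotient_of_compact_group (quot E),
      clopen (graph_of E) \/ at_least_continuum [set: quot E]
    & ~ closed (graph_of E) ->
      forall Y : set X, Y !=set0 -> closed Y -> saturated E Y ->
        at_least_continuum (restricted_classes E Y)].
Proof.
move=> [Z [F [c [[Gt [eqv [i [pgl _]]]] [phi [phiM FE [a _ aP]]]]]]] aE.
exact: (dominated_conclusion pgl phiM FE aP aE).
Qed.
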